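(* Let $A\subset B$ be an extension of commutative rings and let ${}^{+}A$ denote the subintegral closure of $A$ in $B$. Let $M$ be an affine positive monoid and $I$ a radical ideal in $M$. Then: (i) The diagram with rows $$1\to\mathcal{I}(A,{}^{+}A)\xrightarrow{\ i\ }\mathcal{I}(A,B)\xrightarrow{\ \phi(A,{}^{+}A,B)\ }\mathcal{I}({}^{+}A,B)\to 1,$$ $$1\to\mathcal{I}\left(\tfrac{A[M]}{IA[M]},\tfrac{{}^{+}A[M]}{I\,{}^{+}A[M]}\right)\to\mathcal{I}\left(\tfrac{A[M]}{IA[M]},\tfrac{B[M]}{IB[M]}\right)\xrightarrow{\ \phi'\ }\mathcal{I}\left(\tfrac{{}^{+}A[M]}{I\,{}^{+}A[M]},\tfrac{B[M]}{IB[M]}\right)\to 1,$$ and vertical maps (from the first row to the second) $\theta(A,{}^{+}A)$, $\theta(A,B)$, $\theta({}^{+}A,B)$, is commutative with exact rows, where $\phi'=\phi\left(\tfrac{A[M]}{IA[M]},\tfrac{{}^{+}A[M]}{I\,{}^{+}A[M]},\tfrac{B[M]}{IB[M]}\right)$. (ii) If $\mathbb{Q}\subset A$, then $\mathcal{I}\left(\tfrac{A[M]}{IA[M]},\tfrac{{}^{+}A[M]}{I\,{}^{+}A[M]}\right)\cong\tfrac{\mathbb{Z}[M]}{I\mathbb{Z}[M]}\otimes_{\mathbb{Z}}\mathcal{I}(A,{}^{+}A)$ as abelian groups.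
   Context: Rings are commutative with $1$. Monoids are commutative, cancellative and torsion-free, written multiplicatively with identity $1$. A monoid is positive if its only invertible element is $1$; it is affine if it is finitely generated and isomorphic to a submonoid of $\mathbb{Z}^d$ for some $d\ge0$. An ideal of a monoid $M$ is a subset $I\subset M$ with $IM\subset I$; it is radical if $x\in M$, $x^n\in I$ for some $n\ge1$ implies $x\in I$. $A[M]$ is the monoid algebra and $IA[M]$ the ideal generated by $I$; there are inclusions $\frac{A[M]}{IA[M]}\subset\frac{{}^{+}A[M]}{I\,{}^{+}A[M]}\subset\frac{B[M]}{IB[M]}$. A ring extension $R\subset S$ is subintegral if $S$ is integral over $R$, $\mathrm{Spec}(S)\to\mathrm{Spec}(R)$ is bijective, and all residue field maps $k(Q\cap R)\to k(Q)$, $Q\in\mathrm{Spec}(S)$, are isomorphisms. The subintegral closure of $R$ in $S$ is the largest subring of $S$ that is a subintegral extension of $R$. For a ring extension $R\subset S$, $\mathcal{I}(R,S)$ is the group of invertible $R$-submodules of $S$ (invertible elements of the monoid of $R$-submodules of $S$ under multiplication, identity $R$). For rings $R\subset S\subset T$: the map $\mathcal{I}(R,S)\to\mathcal{I}(R,T)$ (denoted $i$ in the first row, and the unnamed first map of the second row) is $J\mapsto J$, and $\phi(R,S,T):\mathcal{I}(R,T)\to\mathcal{I}(S,T)$ is $J\mapsto JS$. For a ring extension $R\subset S$, $\theta(R,S):\mathcal{I}(R,S)\to\mathcal{I}\left(\frac{R[M]}{IR[M]},\frac{S[M]}{IS[M]}\right)$ sends $J$ to the $\frac{R[M]}{IR[M]}$-submodule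 of $\frac{S[M]}{IS[M]}$ generated by (the image of) $J$. *)

(* Defs.v *)
From HB Require Import structures.
From mathcomp Require Import all_boot all_order all_algebra finmap.
From mathcomp Require Import monalg.
From mathcomp Require Import mathcomp_extra boolp classical_sets functions.

Set Implicit Arguments.
Unset Strict Implicit.
Unset Printing Implicit Defensive.

Import GRing.Theory.
Local Open Scope classical_set_scope.
Local Open Scope quotient_scope.
Local Open Scope ring_scope.

(******************************************************************************)
(* Rings are [comPzRingType]s, so that the zero ring is allowed (it occurs    *)
(* below as A[M]/IA[M] when I = M).  A ring extension R c S is an injective   *)
(* morphism R -> S; the notions attached to an extension are defined for any  *)
(* morphism, R being replaced by its image.                                   *)
(******************************************************************************)

Definition is_ideal (R : comPzRingType) (J : set R) : Prop :=
  [/\ J 0, forall x y, J x -> J y -> J (x + y) & forall a x, J x -> J (a * x)].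

Record ideal (R : comPzRingType) := Ideal {
  ideal_set :> R -> Prop;
  idealP : is_ideal ideal_set
}.

Definition ideal_pred (R : comPzRingType) (J : ideal R) : {pred R} :=
  fun x => `[< J x >].

Section QuotientRing.
Variables (R : comPzRingType) (J : ideal R).

Lemma ideal_predE x : (x \in ideal_pred J) = `[< J x >]. Proof. by []. Qed.

Lemma ideal_pred_zmod_closed : zmod_closed (ideal_pred J).
Proof.
have [J0 JD JM] := idealP J.
split=> [|x y /asboolP Jx /asboolP Jy]; apply/asboolP => //.
by rewrite -mulN1r; apply: JD => //; apply: JM.
Qed.

HB.instance Definition _ :=
  GRing.isZmodClosed.Build R (ideal_pred J) ideal_pred_zmod_closed.

(* MathComp gives {ideal_quot _} a ring structure only for a proper ideal of  *)
(* a nonzero ring; this copy of the quotient group has one for every J.       *)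
Definition quotr : Type := {ideal_quot ideal_pred J}.

HB.instance Definition _ := GRing.Zmodule.on quotr.

Definition quot_proj (x : R) : quotr := \pi_({ideal_quot ideal_pred J}) x.

Lemma quot_projP x y : quot_proj x = quot_proj y <-> J (x - y).
Proof.
split=> [/eqP|Jxy].
  by rewrite /quot_proj -Quotient.idealrBE => /asboolP.
by apply/eqP; rewrite /quot_proj -Quotient.idealrBE; apply/asboolP.
Qed.

Lemma quot_projK (x : quotr) : quot_proj (repr x) = x.
Proof. exact: reprK. Qed.

Lemma quot_proj_zmod_morphism : zmod_morphism quot_proj.
Proof. by move=> x y; rewrite /quot_proj -[LHS]/(\pi_({ideal_quot ideal_pred J}) (x - y)) raddfB. Qed.

HB.instance Definition _ :=
  GRing.isZmodMorphism.Build R quotr quot_proj quot_proj_zmod_morphism.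

Definition quot_mul (x y : quotr) : quotr := quot_proj (repr x * repr y).

Lemma quot_projM x y :
  quot_proj (x * y) = quot_mul (quot_proj x) (quot_proj y).
Proof.
have [_ JD JM] := idealP J.
apply/quot_projP.
have Jr z : J (z - repr (quot_proj z)) by apply/quot_projP; rewrite quot_projK.
rewrite -[x * y](subrK (x * repr (quot_proj y))) -mulrBr -addrA -mulrBl.
by apply: JD; [apply: JM | rewrite mulrC; apply: JM].
Qed.

Lemma quot_ind (P : quotr -> Prop) :
  (forall x, P (quot_proj x)) -> forall x, P x.
Proof. by move=> Pp x; rewrite -[x]quot_projK. Qed.

Lemma quot_mulA : associative quot_mul.
Proof.
elim/quot_ind=> x; elim/quot_ind=> y; elim/quot_ind=> z.
by rewrite -!quot_projM mulrA.
Qed.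

Lemma quot_mulC : commutative quot_mul.
Proof. by move=> x y; rewrite /quot_mul mulrC. Qed.

Lemma quot_mul1 : left_id (quot_proj 1) quot_mul.
Proof. by elim/quot_ind=> x; rewrite -quot_projM mul1r. Qed.

Lemma quot_mulDl : left_distributive quot_mul +%R.
Proof.
elim/quot_ind=> x; elim/quot_ind=> y; elim/quot_ind=> z.
by rewrite -raddfD -!quot_projM mulrDl raddfD.
Qed.

HB.instance Definition _ :=
  GRing.Zmodule_isComPzRing.Build quotr
    quot_mulA quot_mulC quot_mul1 quot_mulDl.

Lemma quot_proj_monoid_morphism : monoid_morphism quot_proj.
Proof. by split=> // x y; exact: quot_projM. Qed.

HB.instance Definition _ :=
  GRing.isMonoidMorphism.Build R quotr quot_proj quot_proj_monoid_morphism.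

End QuotientRing.

Section QuotientMap.
Variables (R S : comPzRingType) (f : {rmorphism R -> S}).
Variables (J : ideal R) (K : ideal S) (fJK : forall x, J x -> K (f x)).

Definition quotr_map of (forall x, J x -> K (f x)) : quotr J -> quotr K :=
  fun x => quot_proj K (f (repr x)).

Lemma quotr_mapE x : quotr_map fJK (quot_proj J x) = quot_proj K (f x).
Proof.
apply/quot_projP; rewrite -rmorphB; apply/fJK/quot_projP.
by rewrite quot_projK.
Qed.

Lemma quotr_map_zmod_morphism : zmod_morphism (quotr_map fJK).
Proof.
elim/quot_ind=> x; elim/quot_ind=> y.
by rewrite -raddfB !quotr_mapE -raddfB -raddfB.
Qed.

Lemma quotr_map_monoid_morphism : monoid_morphism (quotr_map fJK).
Proof.
split; first by rewrite -(rmorph1 (quot_proj J)) quotr_mapE !rmorph1.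
elim/quot_ind=> x; elim/quot_ind=> y.
by rewrite -rmorphM !quotr_mapE !rmorphM.
Qed.

HB.instance Definition _ := GRing.isZmodMorphism.Build (quotr J) (quotr K)
  (quotr_map fJK) quotr_map_zmod_morphism.
HB.instance Definition _ := GRing.isMonoidMorphism.Build (quotr J) (quotr K)
  (quotr_map fJK) quotr_map_monoid_morphism.

End QuotientMap.

Record Spec (R : comPzRingType) := PrimeIdeal {
  prime_ideal :> ideal R;
  prime_ideal_proper : ~ prime_ideal 1;
  prime_idealM : forall x y,
    prime_ideal (x * y) -> prime_ideal x \/ prime_ideal y
}.

Section ResidueField.
Variables (R : comPzRingType) (P : Spec R).

Definition residue_domain : Type := quotr P.

HB.instance Definition _ := GRing.ComPzRing.on residue_domain.

Lemma residue_domain_oner_neq0 : (1 : residue_domain) != 0.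
Proof.
apply/eqP => e; have /quot_projP : quot_proj P 1 = quot_proj P 0.
  by rewrite raddf0.
by rewrite subr0 => /prime_ideal_proper.
Qed.

HB.instance Definition _ :=
  GRing.PzSemiRing_isNonZero.Build residue_domain residue_domain_oner_neq0.

Definition residue_unit : {pred residue_domain} :=
  fun x => `[< exists y, y * x = 1 >].

Definition residue_inv (x : residue_domain) : residue_domain :=
  if pselect (exists y, y * x = 1) is left ex then projT1 (cid ex) else x.

Lemma residue_mulVx : {in residue_unit, left_inverse 1 residue_inv *%R}.
Proof.
move=> x /asboolP ex; rewrite /residue_inv.
by case: pselect => // ex'; case: cid.
Qed.

Lemma residue_unitPl (x y : residue_domain) : y * x = 1 -> residue_unit x.
Proof. by move=> yx; apply/asboolP; exists y. Qed.

Lemma residue_invr_out : {in [predC residue_unit], residue_inv =1 id}.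
Proof.
by move=> x /asboolP nex; rewrite /residue_inv; case: pselect.
Qed.

HB.instance Definition _ := GRing.ComNzRing_hasMulInverse.Build residue_domain
  residue_mulVx residue_unitPl residue_invr_out.

Lemma residue_domain_integral (x y : residue_domain) :
  x * y = 0 -> (x == 0) || (y == 0).
Proof.
have P0 z : quot_proj P z = 0 <-> P z.
  by rewrite -[0](raddf0 (quot_proj P)) quot_projP subr0.
elim/quot_ind: x => x; elim/quot_ind: y => y.
rewrite -[_ * _](rmorphM (quot_proj P)) => /P0 /prime_idealM[] /P0 ->.
  by rewrite eqxx.
by rewrite eqxx orbT.
Qed.

HB.instance Definition _ :=
  GRing.ComUnitRing_isIntegral.Build residue_domain residue_domain_integral.

Definition residue_field : fieldType := {fraction residue_domain}.

End ResidueField.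
Section FracMap.
Variables (D E : idomainType) (g : {rmorphism D -> E}).

Local Notation "x %:F" := (FracField.tofrac x) : ring_scope.

Definition frac_map of injective g : {fraction D} -> {fraction E} :=
  fun x => (g \n_(repr x))%:F / (g \d_(repr x))%:F.

Hypothesis g_inj : injective g.

Lemma frac_ndE (x : {fraction D}) : x = (\n_(repr x))%:F / (\d_(repr x))%:F.
Proof.
elim/quotW: x => r; set r' := repr _.
have {1}-> : \pi_{fraction D} r = \pi r' by rewrite /r' reprK.
rewrite -[RHS]/(FracField.mul _ (FracField.inv _)) !piE.
apply/eqmodP; rewrite /= FracField.equivfE /FracField.mulf /FracField.invf.
by rewrite !numden_Ratio ?oner_eq0 ?denom_ratioP // ?mulr1 ?mul1r 1?mulrC
  ?denom_ratioP.
Qed.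

Lemma frac_ind (P : {fraction D} -> Prop) :
  (forall a b, b != 0 -> P (a%:F / b%:F)) -> forall x, P x.
Proof. by move=> h x; rewrite [x]frac_ndE; apply: h; apply: denom_ratioP. Qed.

Lemma tofrac_neq0 (D' : idomainType) (z : D') : z != 0 -> z%:F != 0.
Proof. by rewrite tofrac_eq0. Qed.

Lemma frac_map_neq0 z : z != 0 -> g z != 0.
Proof. by rewrite raddf_eq0. Qed.

Lemma frac_mapE a b : b != 0 ->
  frac_map g_inj (a%:F / b%:F) = (g a)%:F / (g b)%:F.
Proof.
move=> b0; rewrite /frac_map; set x := a%:F / b%:F.
have d0 : \d_(repr x) != 0 by apply: denom_ratioP.
have /eqP := frac_ndE x.
rewrite {1}/x eqr_div ?tofrac_neq0 // -!tofracM tofrac_eq => /eqP e.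
apply/eqP; rewrite eqr_div ?tofrac_neq0 ?frac_map_neq0 //.
by rewrite -!tofracM tofrac_eq -!rmorphM e.
Qed.

Lemma frac_map_zmod_morphism : zmod_morphism (frac_map g_inj).
Proof.
elim/frac_ind=> a b b0; elim/frac_ind=> c d d0.
rewrite -mulNr addf_div ?tofrac_neq0 // -tofracN -!tofracM -tofracD.
rewrite !frac_mapE ?mulf_neq0 //.
rewrite -mulNr addf_div ?tofrac_neq0 ?frac_map_neq0 //.
by rewrite -tofracN -!tofracM -tofracD rmorphD !rmorphM rmorphN.
Qed.

Lemma frac_map_monoid_morphism : monoid_morphism (frac_map g_inj).
Proof.
split.
  rewrite -[X in frac_map _ X]divr1 -(tofrac1 D).
  by rewrite frac_mapE ?oner_neq0 // rmorph1 divff // tofrac_eq0 oner_neq0.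
elim/frac_ind=> a b b0; elim/frac_ind=> c d d0.
rewrite mulf_div -!tofracM !frac_mapE ?mulf_neq0 //.
by rewrite mulf_div -!tofracM !rmorphM.
Qed.

HB.instance Definition _ :=
  GRing.isZmodMorphism.Build {fraction D} {fraction E} (frac_map g_inj)
    frac_map_zmod_morphism.
HB.instance Definition _ :=
  GRing.isMonoidMorphism.Build {fraction D} {fraction E} (frac_map g_inj)
    frac_map_monoid_morphism.

End FracMap.

Section ResidueMap.
Variables (R S : comPzRingType) (f : {rmorphism R -> S}) (Q : Spec S).

Lemma contraction_is_ideal : is_ideal (fun x : R => Q (f x)).
Proof.
have [Q0 QD QM] := idealP Q.
split=> [|x y|a x]; first by rewrite rmorph0.
  by rewrite rmorphD; apply: QD.
by rewrite rmorphM; apply: QM.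
Qed.

Lemma contraction_proper : ~ Q (f 1).
Proof. by rewrite rmorph1; apply: prime_ideal_proper. Qed.

Lemma contraction_prime x y : Q (f (x * y)) -> Q (f x) \/ Q (f y).
Proof. by rewrite rmorphM; apply: prime_idealM. Qed.

Definition contraction : Spec R :=
  @PrimeIdeal R (Ideal contraction_is_ideal)
    contraction_proper contraction_prime.

Definition residue_domain_map : residue_domain contraction -> residue_domain Q :=
  @quotr_map R S f contraction Q (fun x => id).

HB.instance Definition _ := GRing.RMorphism.on residue_domain_map.

Lemma residue_domain_map_inj : injective residue_domain_map.
Proof.
elim/quot_ind=> x; elim/quot_ind=> y; rewrite /residue_domain_map !quotr_mapE.
by move/quot_projP; rewrite -rmorphB => Qxy; apply/quot_projP.
Qed.

Definition residue_map : residue_field contraction -> residue_field Q :=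
  frac_map residue_domain_map_inj.

HB.instance Definition _ := GRing.RMorphism.on residue_map.

End ResidueMap.

Arguments contraction {R S} f Q.
Arguments residue_map {R S} f Q _.

(* Coefficients are listed rather than packed in a {poly R}, which MathComp   *)
(* only provides over nonzero rings.                                          *)
Definition integral_extension (R S : comPzRingType) (f : {rmorphism R -> S}) :=
  forall s : S, exists n (c : 'I_n -> R),
    s ^+ n + \sum_(i < n) f (c i) * s ^+ i = 0.

Definition subintegral (R S : comPzRingType) (f : {rmorphism R -> S}) : Prop :=
  [/\ injective f,
      integral_extension f,
      bijective (contraction f) &
      forall Q : Spec S, bijective (residue_map f Q)].

Record intermediate (R S : comPzRingType) (f : {rmorphism R -> S}) :=
  Intermediate {
    int_set :> S -> Prop;
    int_base : forall r, int_set (f r);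
    int_subr : forall x y, int_set x -> int_set y -> int_set (x - y);
    int_mulr : forall x y, int_set x -> int_set y -> int_set (x * y)
  }.

Section IntermediateRing.
Variables (R S : comPzRingType) (f : {rmorphism R -> S}) (C : intermediate f).

Definition int_pred : {pred S} := fun x => `[< C x >].

Lemma int_pred_subring_closed : subring_closed int_pred.
Proof.
split=> [|x y /asboolP Cx /asboolP Cy|x y /asboolP Cx /asboolP Cy];
  apply/asboolP.
- by rewrite -(rmorph1 f); apply: int_base.
- exact: int_subr.
- exact: int_mulr.
Qed.

Definition int_ring : Type := {x : S | x \in int_pred}.

HB.instance Definition _ := SubChoice.on int_ring.
HB.instance Definition _ := GRing.SubChoice_isSubComPzRing.Build S int_pred
  int_ring int_pred_subring_closed.

Definition int_val : int_ring -> S := val.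

HB.instance Definition _ := GRing.RMorphism.on int_val.

Definition int_incl (r : R) : int_ring := Sub (f r) (asboolT (int_base C r)).

Lemma int_inclK r : int_val (int_incl r) = f r.
Proof. exact: SubK. Qed.

Lemma int_incl_zmod_morphism : zmod_morphism int_incl.
Proof.
by move=> x y; apply: val_inj; rewrite [RHS]raddfB; exact: rmorphB.
Qed.

Lemma int_incl_monoid_morphism : monoid_morphism int_incl.
Proof.
split=> [|x y]; apply: val_inj; first by rewrite [RHS]rmorph1; exact: rmorph1.
by rewrite [RHS]rmorphM; exact: rmorphM.
Qed.

HB.instance Definition _ :=
  GRing.isZmodMorphism.Build R int_ring int_incl int_incl_zmod_morphism.
HB.instance Definition _ :=
  GRing.isMonoidMorphism.Build R int_ring int_incl int_incl_monoid_morphism.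

End IntermediateRing.

Definition is_subintegral_closure (R S : comPzRingType)
    (f : {rmorphism R -> S}) (C : intermediate f) : Prop :=
  subintegral (int_incl C) /\
  forall C' : intermediate f, subintegral (int_incl C') -> forall x, C' x -> C x.

Section Submodules.
Variables (R S : comPzRingType) (f : {rmorphism R -> S}).

Definition is_submod (J : set S) : Prop :=
  [/\ J 0, forall x y, J x -> J y -> J (x + y) & forall r x, J x -> J (f r * x)].

Definition mod_span (X : set S) : set S := smallest is_submod X.

Definition mod_mul (J K : set S) : set S :=
  mod_span [set x * y | x in J & y in K].

Definition mod_one : set S := range f.

Definition mod_invertible (J : set S) : Prop :=
  is_submod J /\ exists2 K, is_submod K & mod_mul J K = mod_one.

Lemma mod_span_submod X : is_submod (mod_span X).
Proof.
split=> [A [[]]//|x y Xx Xy A hA|r x Xx A hA]; have [[_ AD AZ] _] := hA.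
  by apply: AD; [apply: Xx | apply: Xy].
by apply: AZ; apply: Xx.
Qed.

Lemma mod_sub_span X : X `<=` mod_span X.
Proof. exact: sub_smallest. Qed.

Lemma mod_span_min X J : is_submod J -> X `<=` J -> mod_span X `<=` J.
Proof. exact: smallest_sub. Qed.

Lemma mod_span_id J : is_submod J -> mod_span J = J.
Proof.
by move=> sJ; apply/seteqP; split; [apply: mod_span_min | apply: mod_sub_span].
Qed.

Lemma mod_mul_submod J K : is_submod (mod_mul J K).
Proof. exact: mod_span_submod. Qed.

Lemma mod_mul_in J K x y : J x -> K y -> mod_mul J K (x * y).
Proof. by move=> Jx Ky; apply: mod_sub_span; exists x => //; exists y. Qed.

Lemma mod_mul_min J K L : is_submod L ->
  (forall x y, J x -> K y -> L (x * y)) -> mod_mul J K `<=` L.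
Proof.
by move=> sL h; apply: mod_span_min => // _ [x Jx [y Ky <-]]; apply: h.
Qed.

Lemma mod_mul_spanl X K L : is_submod L ->
  (forall x y, X x -> K y -> L (x * y)) -> mod_mul (mod_span X) K `<=` L.
Proof.
move=> sL h; have [L0 LD LZ] := sL.
apply: mod_mul_min => // x y Xx Ky; move: x Xx.
apply: (@mod_span_min X (fun x => L (x * y))) => [|x Xx]; last exact: h.
split=> [|x z Lx Lz|r x Lx]; first by rewrite mul0r.
  by rewrite mulrDl; apply: LD.
by rewrite -mulrA; apply: LZ.
Qed.

Lemma mod_mulC : commutative mod_mul.
Proof.
suff h J K : mod_mul J K `<=` mod_mul K J.
  by move=> J K; apply/seteqP; split; apply: h.
apply: mod_mul_min; first exact: mod_mul_submod.
by move=> x y Jx Ky; rewrite mulrC; apply: mod_mul_in.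
Qed.

Lemma mod_mulA : associative mod_mul.
Proof.
suff h J K L : mod_mul (mod_mul J K) L `<=` mod_mul J (mod_mul K L).
  move=> J K L; apply/seteqP; split; last exact: h.
  rewrite (mod_mulC J (mod_mul K L)) (mod_mulC K L) (mod_mulC (mod_mul J K)).
  by rewrite (mod_mulC J K); apply: h.
apply: mod_mul_spanl; first exact: mod_mul_submod.
move=> _ z [x Jx [y Ky <-]] Lz; rewrite -mulrA.
by do 2!apply: mod_mul_in => //.
Qed.

Lemma mod_one_submod : is_submod mod_one.
Proof.
split=> [|_ _ [x _ <-] [y _ <-]|r _ [x _ <-]]; first by exists 0; rewrite ?rmorph0.
  by exists (x + y); rewrite ?rmorphD.
by exists (r * x); rewrite ?rmorphM.
Qed.

Lemma mod_mul1 J : is_submod J -> mod_mul mod_one J = J.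
Proof.
move=> sJ; apply/seteqP; split; last first.
  by move=> x Jx; rewrite -[x]mul1r -(rmorph1 f); apply: mod_mul_in => //; exists 1.
by apply: mod_mul_min => // _ y [x _ <-] Jy; case: sJ => _ _; apply.
Qed.

Lemma mod_invertible_mul J K :
  mod_invertible J -> mod_invertible K -> mod_invertible (mod_mul J K).
Proof.
move=> [sJ [J' sJ' JJ']] [sK [K' sK' KK']].
split; first exact: mod_mul_submod.
exists (mod_mul K' J'); first exact: mod_mul_submod.
by rewrite mod_mulA -(mod_mulA J) KK' (mod_mulC J) mod_mul1.
Qed.

Lemma mod_invertible_one : mod_invertible mod_one.
Proof.
have s1 := mod_one_submod; split=> //; exists mod_one => //.
exact: mod_mul1.
Qed.

Lemma mod_inverse_exists J : mod_invertible J ->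
  {K | mod_invertible K & mod_mul K J = mod_one}.
Proof.
move=> [sJ h]; apply: cid2; case: h => K sK JK; exists K; last by rewrite mod_mulC.
by split=> //; exists J; rewrite // mod_mulC.
Qed.

Record inv_mod := InvMod {
  inv_set :> S -> Prop;
  inv_mod_invertible : mod_invertible inv_set
}.

HB.instance Definition _ := gen_eqMixin inv_mod.
HB.instance Definition _ := gen_choiceMixin inv_mod.

Lemma inv_mod_eq (J K : inv_mod) : inv_set J = inv_set K -> J = K.
Proof.
by case: J K => [J hJ] [K hK] /= e; subst K; rewrite (Prop_irrelevance hJ hK).
Qed.

Definition inv_mod_mul (J K : inv_mod) : inv_mod :=
  InvMod (mod_invertible_mul (inv_mod_invertible J) (inv_mod_invertible K)).

Definition inv_mod_one : inv_mod := InvMod mod_invertible_one.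

Definition inv_mod_inv (J : inv_mod) : inv_mod :=
  InvMod (s2valP (mod_inverse_exists (inv_mod_invertible J))).

Lemma inv_mod_mulA : associative inv_mod_mul.
Proof. by move=> J K L; apply: inv_mod_eq; exact: mod_mulA. Qed.

Lemma inv_mod_mulC : commutative inv_mod_mul.
Proof. by move=> J K; apply: inv_mod_eq; exact: mod_mulC. Qed.

Lemma inv_mod_mul1 : left_id inv_mod_one inv_mod_mul.
Proof.
by move=> J; apply: inv_mod_eq; apply: mod_mul1; case: (inv_mod_invertible J).
Qed.

Lemma inv_mod_mulV : left_inverse inv_mod_one inv_mod_inv inv_mod_mul.
Proof.
move=> J; apply: inv_mod_eq.
exact: (s2valP' (mod_inverse_exists (inv_mod_invertible J))).
Qed.

(* Abelian groups being [zmodType]s, the group I(R, S) is written additively: *)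
(* J + K is the product of the submodules J and K, and 0 is R.                *)
HB.instance Definition _ := GRing.isZmodule.Build inv_mod
  inv_mod_mulA inv_mod_mulC inv_mod_mul1 inv_mod_mulV.

End Submodules.

Section BaseChange.
Variables (R S R' S' : comPzRingType).
Variables (f : {rmorphism R -> S}) (f' : {rmorphism R' -> S'}).
Variables (g : {rmorphism S -> S'}) (gf : forall r, mod_one f' (g (f r))).

Definition mod_map (J : set S) : set S' := mod_span f' (g @` J).

Lemma mod_map_in (J : set S) x : J x -> mod_map J (g x).
Proof. by move=> Jx; apply: mod_sub_span; exists x. Qed.

Lemma mod_map_preim L : is_submod f' L -> is_submod f (g @^-1` L).
Proof.
case=> L0 LD LZ; split=> [|x y Lx Ly|r x Lx] /=; first by rewrite rmorph0.
  by rewrite rmorphD; apply: LD.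
by rewrite rmorphM; have [r' _ <-] := gf r; apply: LZ.
Qed.

Lemma mod_map_span X : mod_map (mod_span f X) = mod_map X.
Proof.
apply/seteqP; split; apply: mod_span_min; try exact: mod_span_submod.
  move=> _ [x Xx <-]; move: x Xx; apply: mod_span_min.
    exact/mod_map_preim/mod_span_submod.
  by move=> x Xx; apply: mod_map_in.
by move=> _ [x Xx <-]; apply: mod_map_in; apply: mod_sub_span.
Qed.

Lemma mod_map_mul J K :
  mod_map (mod_mul f J K) = mod_mul f' (mod_map J) (mod_map K).
Proof.
rewrite [LHS]mod_map_span; apply/seteqP; split.
  apply: mod_span_min; first exact: mod_mul_submod.
  move=> _ [_ [x Jx [y Ky <-]] <-]; rewrite rmorphM.
  by apply: mod_mul_in; apply: mod_map_in.
apply: mod_mul_spanl; first exact: mod_span_submod.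
move=> _ y [x Jx <-]; move: y; apply: (@mod_span_min _ _ f' _
    (fun y => mod_map [set x * y | x in J & y in K] (g x * y))).
  have [s0 sD sZ] := mod_span_submod f' (g @` [set x * y | x in J & y in K]).
  split=> [|y z hy hz|r y hy]; first by rewrite mulr0.
    by rewrite mulrDr; apply: sD.
  by rewrite mulrCA; apply: sZ.
move=> _ [y Ky <-]; rewrite -rmorphM.
by apply: mod_map_in; exists x => //; exists y.
Qed.

Lemma mod_map_one : mod_map (mod_one f) = mod_one f'.
Proof.
apply/seteqP; split.
  apply: mod_span_min; first exact: mod_one_submod.
  by move=> _ [_ [r _ <-] <-].
have [_ _ sZ] := mod_span_submod f' (g @` mod_one f).
move=> _ [r _ <-]; rewrite -[f' r]mulr1 -(rmorph1 g); apply: sZ.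
by apply: mod_map_in; exists 1; rewrite ?rmorph1.
Qed.

Lemma mod_map_invertible J : mod_invertible f J -> mod_invertible f' (mod_map J).
Proof.
move=> [sJ [K sK JK]]; split; first exact: mod_span_submod.
exists (mod_map K); first exact: mod_span_submod.
by rewrite -mod_map_mul JK mod_map_one.
Qed.

Lemma mod_map_zmod_morphism (F : inv_mod f -> inv_mod f') :
  (forall J, inv_set (F J) = mod_map (inv_set J)) -> zmod_morphism F.
Proof.
move=> FE.
have FD J K : F (J + K) = F J + F K.
  by apply: inv_mod_eq; rewrite [RHS]/(mod_mul f' (F J) (F K)) !FE mod_map_mul.
by move=> J K; apply: (addIr (F K)); rewrite -FD !subrK.
Qed.

End BaseChange.

Section Tower.
Variables (R S T : comPzRingType).
Variables (f : {rmorphism R -> S}) (g : {rmorphism S -> T}).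
Variables (h : {rmorphism R -> T}) (gf : forall r, g (f r) = h r).

Lemma tower_base r : mod_one h (g (f r)).
Proof. by exists r; rewrite ?gf. Qed.

Lemma tower_base_id r : mod_one g (idfun (h r)).
Proof. by exists (f r); rewrite ?gf. Qed.

Lemma image_submodE (J : set S) : is_submod f J -> g @` J = mod_map h g J.
Proof.
case=> J0 JD JZ; rewrite /mod_map mod_span_id //.
split=> [|_ _ [x Jx <-] [y Jy <-]|r _ [x Jx <-]].
- by exists 0; rewrite ?rmorph0.
- by exists (x + y); rewrite ?rmorphD //; apply: JD.
- by exists (f r * x); rewrite ?rmorphM ?gf //; apply: JZ.
Qed.

Lemma extend_modE (J : set T) : mod_mul g J (range g) = mod_map g idfun J.
Proof.
apply/seteqP; split.
  have [_ _ sZ] := mod_span_submod g (idfun @` J).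
  apply: mod_mul_min => [|x _ Jx [s _ <-]]; first exact: mod_span_submod.
  by rewrite mulrC; apply: sZ; apply: (@mod_map_in _ _ _ g idfun).
apply: mod_span_min; first exact: mod_mul_submod.
have r1 : range g 1 by exists 1; rewrite ?rmorph1.
by move=> _ [x Jx <-]; rewrite /= -[x]mulr1; apply: mod_mul_in.
Qed.

Lemma image_mod_invertible J : mod_invertible f J -> mod_invertible h (g @` J).
Proof.
move=> iJ; rewrite image_submodE; last by case: iJ.
exact: mod_map_invertible tower_base _ iJ.
Qed.

Lemma extend_mod_invertible J :
  mod_invertible h J -> mod_invertible g (mod_mul g J (range g)).
Proof.
by move=> iJ; rewrite extend_modE; apply: mod_map_invertible tower_base_id _ iJ.
Qed.

(* J |-> J, viewed in T. *)
Definition inv_incl : inv_mod f -> inv_mod h :=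
  fun J => InvMod (image_mod_invertible (inv_mod_invertible J)).

(* J |-> JS; both factors are subsets of T. *)
Definition inv_extend : inv_mod h -> inv_mod g :=
  fun J => InvMod (extend_mod_invertible (inv_mod_invertible J)).

Lemma inv_incl_zmod_morphism : zmod_morphism inv_incl.
Proof.
apply: (mod_map_zmod_morphism tower_base) => J.
by apply: image_submodE; case: (inv_mod_invertible J).
Qed.

Lemma inv_extend_zmod_morphism : zmod_morphism inv_extend.
Proof.
by apply: (mod_map_zmod_morphism tower_base_id) => J; apply: extend_modE.
Qed.

HB.instance Definition _ := GRing.isZmodMorphism.Build
  (inv_mod f) (inv_mod h) inv_incl inv_incl_zmod_morphism.
HB.instance Definition _ := GRing.isZmodMorphism.Build
  (inv_mod h) (inv_mod g) inv_extend inv_extend_zmod_morphism.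

End Tower.

Section MonoidAlgebra.
Variables (R : comPzRingType) (M : conomType).
Implicit Types (a b c : {malg R[M]}) (x y : M).

(* MathComp makes {malg R[M]} a ring for nonzero R; here is the same          *)
(* multiplication on the same additive group, for every R.                    *)
Definition monoid_algebra : Type := {malg R[M]}.

HB.instance Definition _ := GRing.Zmodule.on monoid_algebra.

Definition ma_mul (a b : monoid_algebra) : monoid_algebra :=
  \sum_(x <- msupp a) \sum_(y <- msupp b) << a@_x * b@_y *g mmul x y >>.

Definition ma_one : monoid_algebra := << 1 *g mone >>.

Lemma ma_mulw (d e : {fset M}) a b : (msupp a `<=` d)%fset ->
  (msupp b `<=` e)%fset ->
  ma_mul a b = \sum_(x <- d) \sum_(y <- e) << a@_x * b@_y *g mmul x y >>.
Proof.
move=> ad be; rewrite /ma_mul (big_fset_incl _ ad) /=.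
  apply/eq_bigr=> x _; apply/big_fset_incl => // y _ /mcoeff_outdom ->.
  by rewrite mulr0 monalgU0.
move=> x _ /mcoeff_outdom ax.
by rewrite big1 // => y _; rewrite ax mul0r monalgU0.
Qed.

Lemma ma_mulC : commutative ma_mul.
Proof.
move=> a b; rewrite /ma_mul exchange_big; apply: eq_bigr => y _.
by apply: eq_bigr => x _; rewrite mulrC mulmC.
Qed.

Lemma ma_mulDl : left_distributive ma_mul +%R.
Proof.
move=> a b c; have cc := fsubset_refl (msupp c).
rewrite (ma_mulw (msuppD_le a b) cc) (ma_mulw (fsubsetUl _ (msupp b)) cc).
rewrite (ma_mulw (fsubsetUr (msupp a) _) cc) -big_split; apply: eq_bigr => x _.
rewrite -big_split; apply: eq_bigr => y _ /=.
by rewrite mcoeffD mulrDl monalgUD.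
Qed.

Lemma ma_mulDr : right_distributive ma_mul +%R.
Proof. by move=> a b c; rewrite !(ma_mulC a) ma_mulDl. Qed.

Lemma ma_mulUU r s x y :
  ma_mul << r *g x >> << s *g y >> = << r * s *g mmul x y >>.
Proof.
by rewrite (ma_mulw msuppU_le msuppU_le) !big_seq_fset1 !mcoeffUU.
Qed.

Lemma ma_ind (P : {malg R[M]} -> Prop) :
  P 0 -> (forall a b, P a -> P b -> P (a + b)) ->
  (forall r x, P << r *g x >>) -> forall a, P a.
Proof. by move=> P0 PD PU a; rewrite [a]monalgE; apply: big_ind. Qed.

Lemma ma_mul0 b : ma_mul 0 b = 0.
Proof. by rewrite /ma_mul msupp0 big_seq_fset0. Qed.

Lemma ma_mulA : associative ma_mul.
Proof.
have m0 b : ma_mul b 0 = 0 by rewrite ma_mulC ma_mul0.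
elim/ma_ind=> [b c|a a' ha ha' b c|r x]; first by rewrite !ma_mul0.
  by rewrite !ma_mulDl ha ha'.
elim/ma_ind=> [c|b b' hb hb' c|s y]; first by rewrite m0 ma_mul0 m0.
  by rewrite ma_mulDl !ma_mulDr ma_mulDl hb hb'.
elim/ma_ind=> [|c c' hc hc'|t z]; first by rewrite !m0.
  by rewrite !ma_mulDr hc hc'.
by rewrite !ma_mulUU mulrA mulmA.
Qed.

Lemma ma_mul1 : left_id ma_one ma_mul.
Proof.
elim/ma_ind=> [|a b ha hb|r x]; first by rewrite ma_mulC ma_mul0.
  by rewrite ma_mulDr ha hb.
by rewrite ma_mulUU mul1r mul1m.
Qed.

HB.instance Definition _ := GRing.Zmodule_isComPzRing.Build monoid_algebra
  ma_mulA ma_mulC ma_mul1 ma_mulDl.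

Definition ma_const (r : R) : monoid_algebra := << r *g mone >>.

Lemma ma_const_zmod_morphism : zmod_morphism ma_const.
Proof. exact: monalgUB. Qed.

Lemma ma_const_monoid_morphism : monoid_morphism ma_const.
Proof. by split=> // r s; rewrite [RHS]ma_mulUU mul1m. Qed.

HB.instance Definition _ := GRing.isZmodMorphism.Build R monoid_algebra
  ma_const ma_const_zmod_morphism.
HB.instance Definition _ := GRing.isMonoidMorphism.Build R monoid_algebra
  ma_const ma_const_monoid_morphism.

End MonoidAlgebra.

Section MonoidAlgebraMap.
Variables (R S : comPzRingType) (f : {rmorphism R -> S}) (M : conomType).

Definition ma_map (a : monoid_algebra R M) : monoid_algebra S M :=
  [malg x in msupp a => f a@_x].

Lemma ma_mapE a x : (ma_map a)@_x = f a@_x.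
Proof. by rewrite mcoeffE; case: msuppP => //; rewrite rmorph0. Qed.

Lemma ma_mapU r x : ma_map << r *g x >> = << f r *g x >>.
Proof. by apply/malgP=> y; rewrite ma_mapE !mcoeffU raddfMn. Qed.

Lemma ma_map_zmod_morphism : zmod_morphism ma_map.
Proof.
by move=> a b; apply/malgP=> x; rewrite mcoeffB !ma_mapE mcoeffB rmorphB.
Qed.

HB.instance Definition _ := GRing.isZmodMorphism.Build
  (monoid_algebra R M) (monoid_algebra S M) ma_map ma_map_zmod_morphism.

Lemma ma_map_monoid_morphism : monoid_morphism ma_map.
Proof.
split=> [|a b]; first by rewrite [LHS]ma_mapU rmorph1.
elim/ma_ind: a => [|a a' ha ha'|r x].
- by rewrite mul0r !raddf0 mul0r.
- by rewrite mulrDl !raddfD /= ha ha' mulrDl.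
elim/ma_ind: b => [|b b' hb hb'|s y].
- by rewrite mulr0 !raddf0 mulr0.
- by rewrite mulrDr !raddfD /= hb hb' mulrDr.
by rewrite !ma_mapU -![_ * _]/(ma_mul _ _) !ma_mulUU ma_mapU rmorphM.
Qed.

HB.instance Definition _ := GRing.isMonoidMorphism.Build
  (monoid_algebra R M) (monoid_algebra S M) ma_map ma_map_monoid_morphism.

End MonoidAlgebraMap.

Section MonomialQuotient.
Variables (R : comPzRingType) (M : conomType) (I : set M).

Definition monomials : set (monoid_algebra R M) := [set << 1 *g x >> | x in I].

Lemma smallest_is_ideal (A : comPzRingType) (X : set A) :
  is_ideal (smallest (@is_ideal A) X).
Proof.
split=> [J [[]]//|x y hx hy J hJ|a x hx J hJ]; have [[_ JD JM] _] := hJ.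
  by apply: JD; [apply: hx | apply: hy].
by apply: JM; apply: hx.
Qed.

Definition monomial_ideal : ideal (monoid_algebra R M) :=
  Ideal (smallest_is_ideal monomials).

Definition monomial_quot : Type := quotr monomial_ideal.

HB.instance Definition _ := GRing.ComPzRing.on monomial_quot.

Definition monomial_quot_const (r : R) : monomial_quot :=
  quot_proj monomial_ideal (ma_const M r).

Lemma monomial_quot_const_zmod_morphism : zmod_morphism monomial_quot_const.
Proof. by move=> r s; rewrite /monomial_quot_const !raddfB. Qed.

Lemma monomial_quot_const_monoid_morphism :
  monoid_morphism monomial_quot_const.
Proof.
by split=> [|r s]; rewrite /monomial_quot_const ?rmorph1 // !rmorphM.
Qed.

HB.instance Definition _ := GRing.isZmodMorphism.Build R monomial_quot
  monomial_quot_const monomial_quot_const_zmod_morphism.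
HB.instance Definition _ := GRing.isMonoidMorphism.Build R monomial_quot
  monomial_quot_const monomial_quot_const_monoid_morphism.

End MonomialQuotient.

Section MonomialQuotientMap.
Variables (R S : comPzRingType) (f : {rmorphism R -> S}).
Variables (M : conomType) (I : set M).

Lemma ma_map_monomial_ideal a :
  monomial_ideal R I a -> monomial_ideal S I (ma_map f a).
Proof.
have [s0 sD sM] := idealP (monomial_ideal S I).
move: a; apply: (@smallest_sub _ _ _
    (fun a => monomial_ideal S I (ma_map f a))) => [|_ [x Ix <-]].
  split=> [|a b ha hb|a b hb]; first by rewrite raddf0.
    by rewrite raddfD; apply: sD.
  by rewrite rmorphM; apply: sM.
by rewrite ma_mapU rmorph1; apply: sub_gen_smallest; exists x.
Qed.

Definition monomial_quot_map : monomial_quot R I -> monomial_quot S I :=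
  quotr_map ma_map_monomial_ideal.

HB.instance Definition _ := GRing.RMorphism.on monomial_quot_map.

Lemma monomial_quot_map_const r :
  monomial_quot_map (monomial_quot_const I r) = monomial_quot_const I (f r).
Proof.
rewrite /monomial_quot_map quotr_mapE; congr quot_proj; exact: ma_mapU.
Qed.

End MonomialQuotientMap.

Arguments monomial_quot_map {R S} f {M} I _.

Lemma monomial_quot_map_comp (R S T : comPzRingType) (f : {rmorphism R -> S})
    (g : {rmorphism S -> T}) (h : {rmorphism R -> T})
    (gf : forall r, g (f r) = h r) (M : conomType) (I : set M) a :
  monomial_quot_map g I (monomial_quot_map f I a) = monomial_quot_map h I a.
Proof.
elim/quot_ind: a => a; rewrite /monomial_quot_map !quotr_mapE.
by congr quot_proj; apply/malgP=> x; rewrite !ma_mapE gf.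
Qed.

Section Theta.
Variables (R S : comPzRingType) (f : {rmorphism R -> S}).
Variables (M : conomType) (I : set M).

Let fI : {rmorphism monomial_quot R I -> monomial_quot S I} :=
  monomial_quot_map f I.

Lemma theta_base r : mod_one fI (monomial_quot_const I (f r)).
Proof. by exists (monomial_quot_const I r) => //; exact: monomial_quot_map_const. Qed.

Definition theta (J : inv_mod f) : inv_mod fI :=
  @InvMod _ _ fI (mod_span fI (@monomial_quot_const S M I @` inv_set J))
    (mod_map_invertible theta_base (inv_mod_invertible J)).

Lemma theta_zmod_morphism : zmod_morphism theta.
Proof. exact: (mod_map_zmod_morphism theta_base). Qed.

HB.instance Definition _ := GRing.isZmodMorphism.Build
  (inv_mod f) (inv_mod fI) theta theta_zmod_morphism.

End Theta.

Arguments theta {R S} f {M} I J.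

(* A [conomType] is a commutative monoid in which x * y = 1 only if           *)
(* x = y = 1, that is, a positive commutative monoid.                         *)

Definition mexp (M : conomType) (x : M) (n : nat) : M := iterop n mmul x mone.

Definition cancellative (M : conomType) : Prop :=
  forall x y z : M, mmul x y = mmul x z -> y = z.

Definition torsion_free (M : conomType) : Prop :=
  forall (x y : M) n, (0 < n)%N -> mexp x n = mexp y n -> x = y.

Definition finitely_generated (M : conomType) : Prop :=
  exists s : seq M, forall x : M, exists2 t : seq M,
    {subset t <= s} & x = \big[mmul/mone]_(y <- t) y.

Definition lattice_embeddable (M : conomType) : Prop :=
  exists d (h : M -> 'rV[int]_d),
    [/\ injective h, h mone = 0 & forall x y, h (mmul x y) = h x + h y].

Definition affine (M : conomType) : Prop :=
  finitely_generated M /\ lattice_embeddable M.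

Definition monoid_ideal (M : conomType) (I : set M) : Prop :=
  forall x y : M, I x -> I (mmul x y).

Definition radical (M : conomType) (I : set M) : Prop :=
  forall (x : M) n, (0 < n)%N -> I (mexp x n) -> I x.

Section MonomialQuotientInjective.
Variables (M : conomType) (I : set M) (idI : monoid_ideal I).

Lemma monomial_idealP (R : comPzRingType) (a : monoid_algebra R M) :
  monomial_ideal R I a <-> forall x, a@_x != 0 -> I x.
Proof.
pose P (b : monoid_algebra R M) := forall x, b@_x != 0 -> I x.
have P0 : P 0 by move=> x; rewrite mcoeff0 eqxx.
have PD b c : P b -> P c -> P (b + c).
  move=> Pb Pc x; rewrite mcoeffD; have [->|/Pb//] := eqVneq b@_x 0.
  by rewrite add0r => /Pc.
have PU r x : I x -> P << r *g x >>.
  by move=> Ix y; rewrite mcoeffU; have [<-|_] := eqVneq x y; rewrite ?mulr0n ?eqxx.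
split=> [|Pa].
  move: a; apply: smallest_sub => [|_ [x Ix <-]]; last exact: PU.
  split=> // b c Pc; rewrite -[b * c]/(ma_mul b c) ma_mulC.
  apply: (big_ind P) => // x _; rewrite big_seq; apply: (big_ind P) => // y _.
  have [->|cx] := eqVneq c@_x 0; first by rewrite mul0r monalgU0.
  exact/PU/idI/Pc.
have [s0 sD sM] := idealP (monomial_ideal R I).
rewrite [a]monalgE big_seq; apply: (big_ind (monomial_ideal R I)) => // x xa.
rewrite -[a@_x]mulr1 -[x in << _ *g x >>]mul1m -ma_mulUU.
apply: (sM (ma_const M a@_x)); apply: sub_gen_smallest; exists x => //.
by apply: Pa; rewrite mcoeff_neq0.
Qed.

Lemma monomial_quot_map_inj (R S : comPzRingType) (f : {rmorphism R -> S}) :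
  injective f -> injective (@monomial_quot_map _ _ f M I).
Proof.
move=> f_inj; elim/quot_ind=> a; elim/quot_ind=> b.
rewrite /monomial_quot_map !quotr_mapE => /quot_projP/monomial_idealP h.
apply/quot_projP/monomial_idealP => x nz; apply: h.
by rewrite -raddfB ma_mapE raddf_eq0.
Qed.

End MonomialQuotientInjective.

Section Tensor.
Variables (U V : zmodType).

Definition is_subgroup (G : zmodType) (H : set G) : Prop :=
  H 0 /\ forall x y, H x -> H y -> H (x - y).

(* {malg int[K]} is the free abelian group on K.                              *)
Definition bilinear_relations : set {malg int[(U * V)%type]} :=
  [set z | (exists u u' v,
              z = << (u + u', v) >> - << (u, v) >> - << (u', v) >>) \/
           (exists u v v',
              z = << (u, v + v') >> - << (u, v) >> - << (u, v') >>)].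

Definition tensor_pred : {pred {malg int[(U * V)%type]}} :=
  fun z => `[< smallest (@is_subgroup {malg int[(U * V)%type]}) bilinear_relations z >].

Lemma tensor_pred_zmod_closed : zmod_closed tensor_pred.
Proof.
split=> [|x y /asboolP hx /asboolP hy]; apply/asboolP => H; first by case=> [[]].
move=> hH; have [[_ HB] _] := hH;
by apply: HB; [apply: hx | apply: hy].
Qed.

HB.instance Definition _ :=
  GRing.isZmodClosed.Build _ tensor_pred tensor_pred_zmod_closed.

Definition tensor : Type := {ideal_quot tensor_pred}.

HB.instance Definition _ := GRing.Zmodule.on tensor.

End Tensor.

Definition short_exact (U V W : zmodType)
    (a : {additive U -> V}) (b : {additive V -> W}) : Prop :=
  [/\ injective a, range a = b @^-1` [set 0] & range b = [set: W]].

(* Main.v *)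
(* Call D c D1 elementary when D1 = D[x] with x^2 and x^3 in D.  By an argument *)
(* of Swan, a subintegral extension is exhausted by towers of elementary ones:  *)
(* if D contains A, is closed under "x^2, x^3 in D => x in D", and misses c in  *)
(* the subintegral extension C of A, then the conductor of D in D[c] is radical *)
(* in D[c], and localising at a minimal prime over it contradicts the           *)
(* triviality of the residue field extensions.  Towers are stable under the     *)
(* passage to A[M]/IA[M], so everything is done step by step.                   *)
(*                                                                              *)
(* Surjectivity of phi: for D1 = D[x], N = xD1 and c = x^2 D1 (an ideal of D1   *)
(* contained in D with N^2 = c), an invertible D1-module is described by an     *)
(* idempotent matrix over D1; it is congruent mod N to a matrix over D, which   *)
(* can be corrected to an idempotent mod c.                                     *)
(*                                                                              *)
(* When A contains Q and C is subintegral over A, I(A, C) is isomorphic to C/A: *)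
(* this is so for an elementary extension, where n in N is sent to the module   *)
(* (1 + n)D + c, i.e. exp(n) D modulo c, and such isomorphisms extend along     *)
(* towers because D/A is divisible (Zorn).  Hence I(A[M]/I, C[M]/I) is          *)
(* C[M]/I modulo A[M]/I, a direct sum of copies of C/A indexed by M \ I.        *)
From HB Require Import structures.
Require Import Defs.
From mathcomp Require Import all_boot all_order all_algebra finmap ring.
From mathcomp Require Import monalg.
From mathcomp Require Import mathcomp_extra boolp classical_sets functions.

Set Implicit Arguments.
Unset Strict Implicit.
Unset Printing Implicit Defensive.

Import GRing.Theory Num.Theory.
Local Open Scope classical_set_scope.
Local Open Scope ring_scope.

(** * Subrings, submodules and invertible modules *)

(** All modules are subsets of one ring [T], and invertibility of $J$ over $D$ is a finite datum: an
    inverse $K$ with $JK\subset D$ and a relation $1=\sum x_iy_i$ with $x_i\in J$, $y_i\in K$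
    ([invp]). If $J\subset J'$ and $J^{-1}\subset J'^{-1}$ then $J=J'$ ([inv_mod_sub_eq]), so
    equalities reduce to inclusions.

    For extensions $R\subset S\subset T$, an invertible $R$-module $J\subset T$ satisfies $JS=S$
    exactly when $J$ and $J^{-1}$ lie in $S$; this gives exactness on the left and in the middle.
    Surjectivity of $\phi$ holds when every element of $S$ is reached from $R$ by adjoining, one
    after another, elements whose square and cube are already present: an invertible module involves
    finitely many elements, hence one such tower ([sn_descent]), and each step of the tower is
    handled by correcting an idempotent matrix ([elementary_descent]). Subintegrality enters through
    Swan's argument ([seminormal_full], [subintegral_sn_hull]), which provides these towers for
    $A\subset{}^+A$. They persist for the monomial quotients ([monomial_sn_hull]), so both rows are
    instances of [tower_short_exact].

    For (ii), [exponential_iso] produces a surjective additive map $S\to\mathcal I(R,S)$ with kernel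
    $R$, both for $A\subset{}^+A$ and for the monomial quotients. It is built along towers: one step
    sends $n$ to $(1+n)D+c$ ([elementary_iso]), and divisibility allows steps to be glued
    ([partial_iso_extend]). Taking coefficients gives a surjection from ${}^+A[M]/I\,{}^+A[M]$ onto
    the tensor product with kernel $A[M]/IA[M]$ ([monomial_tensor]); two surjections with the same
    kernel have isomorphic targets. *)

Section Subrings.
Variable T : comPzRingType.
Implicit Types (D E J K : set T) (x y z : T).

Definition subring D : Prop :=
  [/\ D 1, forall x y, D x -> D y -> D (x - y) &
      forall x y, D x -> D y -> D (x * y)].

Definition smod D J : Prop :=
  [/\ J 0, forall x y, J x -> J y -> J (x + y) &
      forall d x, D d -> J x -> J (d * x)].

Definition mulset J K : set T := [set z | exists2 s : seq (T * T),
  forall p, p \in s -> J p.1 /\ K p.2 & z = \sum_(p <- s) p.1 * p.2].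

(** Since $JK$ is a [D]-module, containing $1$ and lying in [D] amounts to $JK=D$. The inverse is
    kept as data so that modules over different subrings can be compared by inclusions. *)
Definition invp D J K : Prop :=
  [/\ smod D J, smod D K, forall x y, J x -> K y -> D (x * y) & mulset J K 1].

Lemma subring0 D : subring D -> D 0.
Proof. by case=> D1 DB _; rewrite -(subrr 1); apply: DB. Qed.

Lemma subringN D x : subring D -> D x -> D (- x).
Proof. by move=> rD Dx; rewrite -sub0r; have [_ DB _] := rD; apply: DB (subring0 rD) Dx. Qed.

Lemma subringD D x y : subring D -> D x -> D y -> D (x + y).
Proof.
move=> rD Dx Dy; have [_ DB _] := rD.
by rewrite -[y]opprK; apply: DB Dx (subringN rD Dy).
Qed.

Lemma subringM D x y : subring D -> D x -> D y -> D (x * y).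
Proof. by case=> _ _; apply. Qed.

Lemma subringX D x n : subring D -> D x -> D (x ^+ n).
Proof.
move=> rD Dx; elim: n => [|n IH]; first by case: rD.
by rewrite exprS; apply: subringM.
Qed.

Lemma subring_smod D E : subring D -> E `<=` D -> smod E D.
Proof.
move=> rD ED; split; first exact: subring0.
  by move=> x y; apply: subringD.
by move=> d x /ED; apply: subringM.
Qed.

Lemma smod_sum D J I (r : seq I) (P : pred I) (F : I -> T) : smod D J ->
  (forall i, P i -> J (F i)) -> J (\sum_(i <- r | P i) F i).
Proof. by case=> J0 JD _ h; apply: big_ind. Qed.

Lemma smod_sum_seq D J (I : eqType) (r : seq I) (F : I -> T) : smod D J ->
  (forall i, i \in r -> J (F i)) -> J (\sum_(i <- r) F i).
Proof. by move=> mJ h; rewrite big_seq; apply: smod_sum mJ _. Qed.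

Lemma subring_sum D I (r : seq I) (P : pred I) (F : I -> T) : subring D ->
  (forall i, P i -> D (F i)) -> D (\sum_(i <- r | P i) F i).
Proof. by move=> rD; apply: smod_sum (subring_smod rD (@subset_refl _ D)). Qed.

Lemma smodN D J x : subring D -> smod D J -> J x -> J (- x).
Proof.
move=> rD [_ _ JZ] Jx; rewrite -mulN1r; apply: JZ => //.
by apply: subringN => //; case: rD.
Qed.

Lemma smod_trans D E J : E `<=` D -> smod D J -> smod E J.
Proof. by move=> ED [J0 JD JZ]; split=> // d x /ED; apply: JZ. Qed.

Lemma mulset_in J K x y : J x -> K y -> mulset J K (x * y).
Proof.
move=> Jx Ky; exists [:: (x, y)]; last by rewrite big_seq1.
by move=> p; rewrite inE => /eqP->.
Qed.

Lemma mulset_smod D J K : smod D J -> smod D (mulset J K).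
Proof.
move=> [J0 JD JZ]; split.
- by exists [::]; rewrite ?big_nil.
- move=> _ _ [s sP ->] [t tP ->]; exists (s ++ t); last by rewrite big_cat.
  by move=> p; rewrite mem_cat => /orP[/sP|/tP].
move=> d _ Dd [s sP ->]; exists [seq (d * p.1, p.2) | p <- s].
  by move=> _ /mapP[p /sP[Jp Kp] ->]; split=> //; apply: JZ.
by rewrite big_map mulr_sumr; apply: eq_bigr => p _; rewrite mulrA.
Qed.

Lemma mulsetC J K : mulset J K `<=` mulset K J.
Proof.
move=> _ [s sP ->]; exists [seq (p.2, p.1) | p <- s].
  by move=> _ /mapP[p /sP[Jp Kp] ->].
by rewrite big_map; apply: eq_bigr => p _; rewrite mulrC.
Qed.

Lemma mulset_min D J K L : smod D L -> (forall x y, J x -> K y -> L (x * y)) ->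
  mulset J K `<=` L.
Proof.
move=> mL h _ [s sP ->]; apply: smod_sum_seq mL _ => p /sP[].
exact: h.
Qed.

Lemma mulset_dist J K L z x : mulset K L x -> (forall y, K y -> J (z * y)) ->
  mulset J L (z * x).
Proof.
move=> [s sP ->] h; rewrite mulr_sumr; exists [seq (z * p.1, p.2) | p <- s].
  by move=> _ /mapP[p /sP[Kp Lp] ->]; split=> //; apply: h.
by rewrite big_map; apply: eq_bigr => p _; rewrite mulrA.
Qed.

Lemma mulset_ord J K z : mulset J K z -> exists n (x y : 'I_n -> T),
  [/\ forall i, J (x i), forall i, K (y i) & z = \sum_i x i * y i].
Proof.
move=> [s sP ->]; exists (size s).
exists (fun i => (tnth (in_tuple s) i).1), (fun i => (tnth (in_tuple s) i).2).
have st i : tnth (in_tuple s) i \in s by apply: mem_tnth.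
by rewrite big_tnth; split=> // i; have [] := sP _ (st i).
Qed.

Lemma mulset_of_ord J K n (x y : 'I_n -> T) :
  (forall i, J (x i)) -> (forall i, K (y i)) -> mulset J K (\sum_i x i * y i).
Proof.
move=> Jx Ky; exists [seq (x i, y i) | i <- enum 'I_n].
  by move=> _ /mapP[i _ ->]; split=> /=.
by rewrite big_map big_enum.
Qed.

Lemma invp_sym D J K : invp D J K -> invp D K J.
Proof.
move=> [mJ mK JK /mulsetC KJ]; split=> // x y Kx Jy.
by rewrite mulrC; apply: JK.
Qed.

(** For $z\in J'$, multiply $z$ by $1\in KJ$ and use $zK\subset J'K'\subset D'$. *)
Lemma invp_generate D D' J K J' K' : invp D J K -> invp D' J' K' ->
  K `<=` K' -> J' `<=` mulset J D'.
Proof.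
move=> [_ _ _ /mulsetC KJ1] [_ _ JK' _] KK z J'z; rewrite -[z]mulr1.
by apply/mulsetC; apply: mulset_dist KJ1 _ => y /KK; apply: JK'.
Qed.

Lemma invp_eq D J K J' K' : invp D J K -> invp D J' K' ->
  J `<=` J' -> K `<=` K' -> J = J'.
Proof.
move=> i i' JJ KK; apply/seteqP; split=> // z /(invp_generate i i' KK).
have [mJ _ _ _] := i.
move: z; apply: (mulset_min mJ) => x d Jx Dd.
by rewrite mulrC; case: mJ => _ _; apply.
Qed.

Lemma invp_inv_eq D J K K' : invp D J K -> invp D J K' -> K = K'.
Proof.
suff h K1 K2 : invp D J K1 -> invp D J K2 -> K1 `<=` K2.
  by move=> i1 i2; apply/seteqP; split; apply: h.
move=> [_ _ JK1 _] [_ mK2 _ JK2] z Kz; rewrite -[z]mulr1.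
have [_ _ K2Z] := mK2; have [s sP ->] := JK2.
rewrite mulr_sumr; apply: (smod_sum_seq mK2) => p /sP[Jp Kp].
by rewrite mulrA; apply: K2Z => //; rewrite mulrC; apply: JK1.
Qed.

End Subrings.

(** * Comparison with the groups of invertible submodules *)

Section Invertible.
Variables (R S : comPzRingType) (f : {rmorphism R -> S}).
Implicit Types J K : set S.

Lemma range_subring : subring (range f).
Proof.
split=> [|_ _ [x _ <-] [y _ <-]|_ _ [x _ <-] [y _ <-]].
- by exists 1; rewrite ?rmorph1.
- by exists (x - y); rewrite ?rmorphB.
- by exists (x * y); rewrite ?rmorphM.
Qed.

Lemma is_submodE J : is_submod f J <-> smod (range f) J.
Proof.
split=> [] [J0 JD JZ]; split=> //; last by move=> r x; apply: JZ; exists r.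
by move=> _ x [r _ <-]; apply: JZ.
Qed.

Lemma mod_mulE J K : is_submod f J -> mod_mul f J K = mulset J K.
Proof.
move=> /is_submodE mJ; apply/seteqP; split.
  apply: mod_mul_min; first exact/is_submodE/mulset_smod.
  by move=> x y; apply: mulset_in.
apply: mulset_min; first exact/is_submodE/mod_mul_submod.
by move=> x y; apply: mod_mul_in.
Qed.

Lemma mod_invertibleP J K : smod (range f) J -> smod (range f) K ->
  mod_mul f J K = mod_one f <-> invp (range f) J K.
Proof.
move=> mJ mK; rewrite mod_mulE; last exact/is_submodE.
split=> [JK|[_ _ JK JK1]].
  split=> // [x y Jx Ky|]; first by rewrite -[range f]JK; apply: mulset_in.
  by rewrite JK; have [] := range_subring.
apply/seteqP; split.
  by apply: mulset_min JK; have [] := is_submodE (mod_one f);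
    move=> + _; apply; apply: mod_one_submod.
move=> _ [r _ <-]; rewrite -[f r]mulr1.
by have [_ _] := mulset_smod K mJ; apply=> //; exists r.
Qed.

Lemma invp_invertible J K : invp (range f) J K -> mod_invertible f J.
Proof.
move=> iJK; have [mJ mK _ _] := iJK; split; first exact/is_submodE.
by exists K; [apply/is_submodE | apply/mod_invertibleP].
Qed.

Lemma inv_modP (J : inv_mod f) : invp (range f) J (- J).
Proof.
have [mJ _] := inv_mod_invertible J; have [mK _] := inv_mod_invertible (- J).
apply/mod_invertibleP; [exact/is_submodE | exact/is_submodE |].
by rewrite mod_mulC; have := addNr J; move/(congr1 (@inv_set _ _ _)).
Qed.

Lemma inv_modN (J : inv_mod f) K : invp (range f) J K -> inv_set (- J) = K.
Proof. by apply: invp_inv_eq; apply: inv_modP. Qed.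

(** Enlarging an invertible module shrinks its inverse, so two inclusions in the same direction must
    be equalities. In practice one inclusion, valid for all modules, is applied to a module and to
    its inverse. *)
Lemma inv_mod_sub_eq (J K : inv_mod f) :
  J `<=` K -> inv_set (- J) `<=` inv_set (- K) -> J = K.
Proof.
by move=> JK NJK; apply: inv_mod_eq; apply: invp_eq JK NJK; apply: inv_modP.
Qed.

Lemma inv_mod_addE (J K : inv_mod f) : inv_set (J + K) = mulset J K.
Proof. by apply: mod_mulE; case: (inv_mod_invertible J). Qed.

End Invertible.

(** * Descent of invertible modules along towers *)

(* b = 3a^2 - 2a^3, written around d. *)
Lemma idempotent_lift (T : comPzRingType) n (a : 'M[T]_n) :
  let d := a * a - a in let b := a + d - (a * d) *+ 2 in
  b * b - b = d * d * (a * a *+ 4 - a *+ 4 - 3%:R).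
Proof.
move=> d b; rewrite /b /d.
rewrite !(mulrDr, mulrDl, mulrN, mulNr, mulrnAl, mulrnAr, mulr1, mulrnDl) .
rewrite !mulrA -!expr2 -!exprSr.
(* The identity is now linear in the powers of [a], so it can be checked entry by entry with these
   powers as unrelated matrices. *)
move: (a ^+ 2) (a ^+ 3) (a ^+ 4) (a ^+ 5) (a ^+ 6) => a2 a3 a4 a5 a6.
apply/matrixP=> i j; rewrite !mxE.
ring.
Qed.

Section Descent.
Variable T : comPzRingType.
Implicit Types (D E J K N c : set T).

Definition mxin J m n (a : 'M[T]_(m, n)) : Prop := forall i j, J (a i j).

Lemma mxin_mul E J K L m n p (a : 'M_(m, n)) (b : 'M_(n, p)) :
  smod E L -> (forall x y, J x -> K y -> L (x * y)) ->
  mxin J a -> mxin K b -> mxin L (a *m b).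
Proof. by move=> mL h Ja Kb i j; rewrite mxE; apply: smod_sum mL _ => k _; apply: h. Qed.

Lemma mxinD E J m n (a b : 'M_(m, n)) :
  smod E J -> mxin J a -> mxin J b -> mxin J (a + b).
Proof. by case=> _ JD _ Ja Jb i j; rewrite mxE; apply: JD. Qed.

Lemma mxinN E J m n (a : 'M_(m, n)) :
  subring E -> smod E J -> mxin J a -> mxin J (- a).
Proof. by move=> rE mJ Ja i j; rewrite mxE; apply: smodN mJ _. Qed.

Lemma mxin_tr E J n (a : 'M_n) : smod E J -> mxin J a -> J (\tr a).
Proof. by move=> mJ Ja; apply: smod_sum mJ _ => i _. Qed.

(* The model case is D1 = D[x] with x^2 and x^3 in D, N = x D1 and            *)
(* c = x^2 D1.                                                                *)
Definition elementary D D1 N c : Prop :=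
  [/\ subring D /\ subring D1, smod D1 N /\ smod D1 c, 
      [/\ D `<=` D1, N `<=` D1 & c `<=` D],
      forall x y, N x -> N y -> c (x * y) &
      forall x, D1 x -> exists2 d, D d & N (x - d)].

(** Lift $e$ to a matrix over $D$ modulo $N$ and improve it to $b$, idempotent modulo $c$. As
    $N^2\subset c$, the difference $u=e-b$ of two idempotents is off-diagonal with respect to $b$:
    $bub\equiv0$ and $\mathrm{tr}\,u\equiv0$ modulo $c$. Hence $beb\equiv b$. The trace clause
    serves to produce $1$ in the product of the descended modules. *)
Lemma idempotent_descent D D1 N c n (e : 'M[T]_n) : elementary D D1 N c ->
  mxin D1 e -> e * e = e ->
  exists b : 'M_n, [/\ mxin D b, mxin D (b * e * b) & c (\tr (b * e * b) - \tr e)].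
Proof.
move=> [[rD rD1] [mN mc] [DD1 ND1 cD] NN D1N] D1e ee.
have mD1 := subring_smod rD1 (@subset_refl _ D1).
have mD := subring_smod rD (@subset_refl _ D).
have [f fP] : exists f : 'I_n -> 'I_n -> T, forall i j, D (f i j) /\ N (e i j - f i j).
  have h i j : {d | D d /\ N (e i j - d)}.
    by apply: cid; have [d] := D1N _ (D1e i j); exists d.
  by exists (fun i j => sval (h i j)) => i j; case: (h i j).
pose a : 'M_n := \matrix_(i, j) f i j; pose v := e - a.
have Da : mxin D a by move=> i j; rewrite mxE; case: (fP i j).
have Nv : mxin N v by move=> i j; rewrite !mxE; case: (fP i j).
have D1a : mxin D1 a by move=> i j; apply: DD1.
have mulD1l J (x y : 'M_n) : smod D1 J -> mxin D1 x -> mxin J y -> mxin J (x * y).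
  by move=> mJ; apply: mxin_mul (mJ) _; case: mJ.
have mulD1r J (x y : 'M_n) : smod D1 J -> mxin J x -> mxin D1 y -> mxin J (x * y).
  move=> mJ; apply: mxin_mul (mJ) _ => z t Jz D1t.
  by rewrite mulrC; case: mJ => _ _; apply.
have NNc (x y : 'M_n) : mxin N x -> mxin N y -> mxin c (x * y).
  exact: mxin_mul (mc) NN.
have DMD (x y : 'M_n) : mxin D x -> mxin D y -> mxin D (x * y).
  by apply: mxin_mul (mD) _ => ? ?; apply: subringM.
have NDD J (x y : 'M_n) : smod D1 J -> mxin J x -> mxin J y -> mxin J (x - y).
  by move=> mJ Jx Jy; apply: mxinD mJ Jx (mxinN rD1 mJ Jy).
pose d := a * a - a.
have Nd : mxin N d.
  have -> : d = v - e * v - v * e + v * v.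
    rewrite /d /v !mulrBl !mulrBr ee.
    by apply/matrixP=> i j; rewrite !mxE; ring.
  apply: mxinD (mN) _ _; last by apply: (mulD1r) => // i j; apply: ND1.
  by apply: (NDD) => //; [apply: (NDD) => //; apply: (mulD1l) | apply: (mulD1r)].
have Dd : mxin D d by apply: mxinD (mD) _ (mxinN rD (mD) Da); apply: DMD.
pose b := a + d - (a * d) *+ 2.
have Db : mxin D b.
  apply: mxinD (mD) _ (mxinN rD (mD) _); first exact: mxinD (mD) _ _.
  by rewrite mulr2n; apply: mxinD (mD) _ _; apply: DMD.
have D1b : mxin D1 b by move=> i j; apply: DD1.
have D1nat k : mxin D1 (k%:R : 'M_n).
  elim: k => [|k IH]; first by move=> i j; rewrite mxE; apply: subring0.
  rewrite -natr1; apply: mxinD mD1 IH _ => i j; rewrite mxE.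
  by case: (i == j); [case: rD1 | apply: subring0].
have cbb : mxin c (b * b - b).
  rewrite idempotent_lift; apply: (mulD1r) => //; first exact: NNc.
  rewrite -(mulr_natr (a * a)) -(mulr_natr a).
  by apply: (NDD) => //; apply: (NDD) => //; apply: (mulD1r) => //; apply: (mulD1r).
pose u := e - b.
have Nu : mxin N u.
  have -> : u = v - d + (a * d) *+ 2.
    by rewrite /u /b /v; apply/matrixP=> i j; rewrite !mxE; ring.
  by rewrite mulr2n; apply: mxinD (mN) _ _; [apply: (NDD) | apply: mxinD (mN) _ _; apply: (mulD1l)].
have eE : e = b + u by rewrite addrC subrK.
(* [g] is the part of $e^2-e$ linear in $u$; the rest is $u^2$ and $b^2-b$, both in $c$. *)
clearbody u b; pose g := b * u + u * b - u.
have cg : mxin c g.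
  have -> : g = - (u * u) - (b * b - b).
    have : e * e - e = 0 by rewrite ee subrr.
    rewrite eE mulrDl !mulrDr => h.
    apply/eqP; rewrite -subr_eq0; apply/eqP; rewrite -[RHS]h /g.
    move: (b * u) (u * b) (b * b) (u * u) => bu ub bb uu;
    by apply/matrixP=> i j; rewrite !mxE; ring.
  by apply: (NDD) => //; apply: mxinN rD1 (mc) _; apply: NNc.
have cbub : mxin c (b * u * b).
  have -> : b * u * b = b * g - (b * b - b) * u.
    rewrite /g !mulrBl !mulrBr mulrDr !mulrA.
    by apply/matrixP=> i j; rewrite !mxE; ring.
  by apply: (NDD) => //; [apply: (mulD1l) | apply: (mulD1r) => // i j; apply: ND1].
have cbeb : mxin c (b * e * b - b).
  have -> : b * e * b - b = b * u * b + (b * b - b) * b + (b * b - b).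
    rewrite eE mulrDr !mulrDl mulNr.
    by apply/matrixP=> i j; rewrite !mxE; ring.
  by apply: mxinD (mc) _ (cbb); apply: mxinD (mc) cbub _; apply: (mulD1r).
exists b; split=> //.
  by rewrite -[b * e * b](subrK b); apply: mxinD (mD) _ Db => i j; apply: cD.
have mtr := mxin_tr mc; have cBB x y : c x -> c y -> c (x - y).
  by move=> cx cy; have [_ cD' _] := mc; apply: cD' => //; apply: smodN mc _.
have ctbu : c (\tr (b * u)).
  have -> : \tr (b * u) = \tr (b * u * b) - \tr ((b * b - b) * u).
    have -> : \tr (b * u * b) = \tr (b * b * u).
      by rewrite -[b * b * u]mulrA; apply: mxtrace_mulC.
    by rewrite mulrBl raddfB /= opprB addrC subrK.
  by apply: cBB; apply: mtr => //; apply: (mulD1r) => // i j; apply: ND1.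
have ctu : c (\tr u).
  have -> : \tr u = \tr (b * u) + \tr (u * b) - \tr g 
    by rewrite [\tr g]raddfB /= [\tr (_ + _)]raddfD /= opprB addrC subrK.
  apply: cBB; last exact: mtr.
  rewrite [\tr (u * b)]mxtrace_mulC; have [_ cD' _] := mc; exact: cD'.
have -> : \tr (b * e * b) - \tr e = \tr (b * e * b - b) - \tr u.
  by rewrite [in RHS]raddfB eE [\tr (b + u)]raddfD /= opprD addrA.
by apply: cBB => //; apply: mtr.
Qed.
(** With $YX=1$ the matrix $e=XY$ is idempotent of trace $1$. The descended modules are generated
    over $D$ by the entries of $bX$ and of $Yb$, together with $cJ$ and $cK$; products of these
    generators are entries of $beb$, hence in $D$. *)
Lemma elementary_descent D D1 N c J K : elementary D D1 N c -> invp D1 J K ->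
  exists J' K', [/\ invp D J' K', J' `<=` J & K' `<=` K].
Proof.
move=> el [mJ mK JK /mulset_ord[n [x [y [Jx Ky xy]]]]].
have [[rD rD1] [mN mc] [DD1 ND1 cD] NN D1N] := el.
pose X : 'cV_n := \col_i x i; pose Y : 'rV_n := \row_i y i.
have YX : Y *m X = 1.
  by apply/rowP=> i; rewrite !mxE xy ord1; apply: eq_bigr => k _; rewrite !mxE mulrC.
pose e : 'M_n := X *m Y.
have eE i j : e i j = x i * y j by rewrite mxE big_ord1 !mxE.
have D1e : mxin D1 e by move=> i j; rewrite eE; apply: JK.
have ee : e * e = e by rewrite /e [LHS]mulmxA -(mulmxA X) YX mulmx1.
have [b [Db Dbeb ctr]] := idempotent_descent el D1e ee.
pose x' i := (b *m X) i 0; pose y' j := (Y *m b) 0 j.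
have xyE i j : x' i * y' j = (b * e * b) i j.
  have -> : b * e * b = (b *m X) *m (Y *m b) by rewrite /e [RHS]mulmxA -(mulmxA b X).
  by rewrite mxE big_ord1.
have Jx' i : J (x' i).
  rewrite /x' mxE; apply: smod_sum (mJ) _ => k _; rewrite mxE.
  by case: mJ => _ _; apply => //; apply: DD1.
have Ky' i : K (y' i).
  rewrite /y' mxE; apply: smod_sum (mK) _ => k _; rewrite mxE mulrC.
  by case: mK => _ _; apply => //; apply: DD1.
have mD := subring_smod rD (@subset_refl _ D).
pose gen (L : set T) (z : 'I_n -> T) : set T := [set t | exists a : 'I_n -> T,
  (forall i, D (a i)) /\ mulset c L (t - \sum_i a i * z i)].
have genin L z i : smod D1 L -> gen L z (z i).
  move=> mL; exists (fun k => (k == i)%:R); split.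
    by move=> k; case: eqP => _; [case: rD | apply: subring0].
  rewrite (bigD1 i) //= eqxx mul1r big1 ?addr0 ?subrr; last first.
    by move=> k /negPf->; rewrite mul0r.
  by have [] := mulset_smod L mc.
have cgen L z : mulset c L `<=` gen L z.
  move=> t ct; exists (fun=> 0); split=> [i|]; first exact: subring0.
  by rewrite big1 ?subr0 // => i _; rewrite mul0r.
have mgen L z : smod D (gen L z).
  have [c0 cA cZ] := smod_trans DD1 (mulset_smod L mc).
  split; first exact: cgen.
    move=> s t [a [Da sa]] [a' [Da' ta]]; exists (fun i => a i + a' i).
    split=> [i|]; first exact: subringD.
    under eq_bigr => i _ do rewrite mulrDl.
    by rewrite big_split /= opprD addrACA; apply: cA.
  move=> d s Dd [a [Da sa]]; exists (fun i => d * a i).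
  split=> [i|]; first exact: subringM.
  under eq_bigr => i _ do rewrite -mulrA.
  by rewrite -mulr_sumr -mulrBr; apply: cZ.
have genE L z t : gen L z t -> exists2 u, mulset c L u & exists2 a : 'I_n -> T,
    forall i, D (a i) & t = \sum_i a i * z i + u.
  by move=> [a [Da ta]]; exists (t - \sum_i a i * z i) => //; exists a; rewrite // addrC subrK.
have cL L : smod D1 L -> mulset c L `<=` L.
  by move=> mL; apply: mulset_min (mL) _ => s t /cD/DD1; case: mL => _ _; apply.
have subgen L z : smod D1 L -> (forall i, L (z i)) -> gen L z `<=` L.
  move=> mL Lz t /genE[u /(cL _ mL) Lu [a Da ->]].
  have [_ LD LZ] := mL; apply: LD => //.
  by apply: smod_sum (mL) _ => i _; apply: LZ => //; apply: DD1.
have cJK s t : mulset c J s -> K t -> c (s * t).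
  move=> + Kt; move: s; apply: (mulset_min (D := D1) (L := fun s => c (s * t))).
    have [c0 cA cZ] := mc.
    split=> [|s s' cs cs'|d s Dd cs]; first by rewrite mul0r.
      by rewrite mulrDl; apply: cA.
    by rewrite -mulrA; apply: cZ Dd _.
  move=> d s cd Js; rewrite -mulrA mulrC.
  by have [_ _ cZ] := mc; apply: cZ => //; apply: JK.
have cKJ s t : J s -> mulset c K t -> c (s * t).
  move=> Js; move: t; apply: (mulset_min (D := D1) (L := fun t => c (s * t))).
    have [c0 cA cZ] := mc.
    split=> [|t t' ct ct'|d t Dd ct]; first by rewrite mulr0.
      by rewrite mulrDr; apply: cA.
    by rewrite mulrCA; apply: cZ Dd _.
  move=> d t cd Kt; rewrite mulrCA mulrC.
  by have [_ _ cZ] := mc; apply: cZ => //; apply: JK.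
exists (gen J x'), (gen K y'); split; try exact: subgen; split; try exact: mgen.
  move=> s t Js Kt.
  have Ks : K t by apply: subgen Kt.
  have [u cu [a Da sE]] := genE _ _ _ Js; have [w cw [a' Da' tE]] := genE _ _ _ Kt.
  rewrite sE mulrDl; apply: subringD (rD) _ (cD _ (cJK _ _ cu Ks)).
  have Jxa : J (\sum_i a i * x' i).
    by apply: smod_sum (mJ) _ => i _; have [_ _ JZ] := mJ; apply: JZ => //; apply: DD1.
  rewrite tE mulrDr; apply: subringD (rD) _ (cD _ (cKJ _ _ Jxa cw)).
  rewrite mulr_suml; apply: subring_sum (rD) _ => i _.
  rewrite mulr_sumr; apply: subring_sum (rD) _ => j _.
  by rewrite mulrACA xyE; do !apply: subringM => //.
(* The trace congruence puts the defect $g$ in $c$. In $1=(1+g)(1-g)+g^2$, the factor $1-g$ is $\sum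
   x'_iy'_i$ and $g^2=\sum(gx_i)(gy_i)$ lies in $cJ\cdot cK$. *)
pose g := 1 - \sum_i x' i * y' i.
have cg : c g.
  have trE : \tr (b * e * b) = \sum_i x' i * y' i by apply: eq_bigr => i _; rewrite xyE.
  have tre : \tr e = 1 by rewrite xy; apply: eq_bigr => i _; rewrite eE.
  by rewrite -[g]opprK; apply: smodN rD1 mc _; rewrite /g opprB -trE -tre.
have mJK := mulset_smod (gen K y') (mgen J x').
have [_ PD PZ] := mJK.
have -> : 1 = (1 + g) * (\sum_i x' i * y' i) + g * g.
  have -> : \sum_i x' i * y' i = 1 - g by rewrite /g opprB addrC subrK.
  by ring.
apply: PD.
  apply: PZ; first by apply: subringD => //; [case: rD | apply: cD].
  by apply: mulset_of_ord => i; apply: genin.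
rewrite -[g * g]mulr1 xy mulr_sumr; apply: smod_sum (mJK) _ => i _.
by rewrite mulrACA; apply: mulset_in; apply: cgen; apply: mulset_in.
Qed.
End Descent.

(** * Towers of elementary extensions and relative seminormalisation *)

Section Towers.
Variable T : comPzRingType.
Implicit Types (C D E J K N c : set T).

(** This is $D[x]$ as soon as $x^2\in D$. *)
Definition adjoin D x : set T := [set z | exists a b, [/\ D a, D b & z = a + b * x]].

(* The adjoined elements are confined to C so that the towers stay inside C. *)
Inductive tower C D : set T -> Prop :=
| tower_refl : tower C D D
| tower_step E x : tower C D E -> C x -> E (x * x) -> E (x * x * x) ->
    tower C D (adjoin E x).

Definition sn_closed C E : Prop :=
  subring E /\ forall x, C x -> E (x * x) -> E (x * x * x) -> E x.

(** For a subring [D] of a ring [C] this is the seminormalisation of [D] in [C]. *)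
Definition sn_hull C D : set T := smallest (sn_closed C) D.

Lemma adjoin_gen D x : subring D -> D `<=` adjoin D x /\ adjoin D x x.
Proof.
move=> rD; have D0 := subring0 rD; have [D1 _ _] := rD; split.
  by move=> z Dz; exists z, 0; rewrite mul0r addr0.
by exists 0, 1; rewrite add0r mul1r.
Qed.

Lemma adjoin_subring D x : subring D -> D (x * x) -> subring (adjoin D x).
Proof.
move=> rD Dxx; have D0 := subring0 rD; have [D1 DB DM] := rD; split.
- by exists 1, 0; rewrite mul0r addr0.
- move=> _ _ [a [b [Da Db ->]]] [a' [b' [Da' Db' ->]]].
  exists (a - a'), (b - b'); split; try exact: DB.
  by ring.
move=> _ _ [a [b [Da Db ->]]] [a' [b' [Da' Db' ->]]].
exists (a * a' + b * b' * (x * x)), (a * b' + b * a').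
split; last by ring.
  by apply: (subringD rD); [apply: DM | apply: (DM) => //; apply: DM].
by apply: (subringD rD); apply: DM.
Qed.

Lemma tower_subring C D E : subring D -> tower C D E -> subring E.
Proof. by move=> rD; elim=> // E' x _ rE _ xx _; apply: adjoin_subring. Qed.

Lemma tower_sub C D E : subring D -> tower C D E -> D `<=` E.
Proof.
move=> rD; elim=> // E' x tE' DE _ _ _ z /DE.
by have [h _] := adjoin_gen x (tower_subring rD tE'); apply: h.
Qed.

(** The steps of the second tower are repeated on top of the first. *)
Lemma tower_join C D E E' : subring D -> tower C D E -> tower C D E' ->
  exists F, [/\ tower C D F, E `<=` F & E' `<=` F].
Proof.
move=> rD tE; elim=> [|{}E' x tE' [F [tF EF E'F]] Cx xx xxx].
  by exists E; split=> [//|x Ex|x Dx]; [exact: Ex | exact: tower_sub rD tE _ Dx].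
have [FF Fx] := adjoin_gen x (tower_subring rD tF).
have rA := adjoin_subring (tower_subring rD tF) (E'F _ xx).
have [_ AD AM] := subring_smod rA (@subset_refl _ _).
exists (adjoin F x); split; first by apply: tower_step => //; apply: E'F.
  by move=> z /EF/FF.
by move=> _ [a [b [/E'F/FF Fa /E'F/FF Fb ->]]]; apply: AD => //; apply: AM.
Qed.

(** Towers are directed, so their union is a subring, and one further step shows that it is closed
    under adjunction; it therefore contains the hull. *)
Lemma sn_hull_tower C D x : subring D -> sn_hull C D x -> exists2 E, tower C D E & E x.
Proof.
move=> rD; move: x; apply: smallest_sub; last by move=> x Dx; exists D => //; left.
have joinP E x E' y : tower C D E -> E x -> tower C D E' -> E' y ->
    exists F, [/\ tower C D F, F x & F y].
  move=> tE Ex tE' E'y; have [F [tF EF E'F]] := tower_join rD tE tE'.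
  by exists F; split=> //; [apply: EF | apply: E'F].
split; first split.
- by exists D; [left | case: rD].
- move=> x y [E tE Ex] [E' tE' E'y]; have [F [tF Fx Fy]] := joinP _ _ _ _ tE Ex tE' E'y.
  by exists F => //; have [_ FB _] := tower_subring rD tF; apply: FB.
- move=> x y [E tE Ex] [E' tE' E'y]; have [F [tF Fx Fy]] := joinP _ _ _ _ tE Ex tE' E'y.
  by exists F => //; have [_ _ FM] := tower_subring rD tF; apply: FM.
move=> x Cx [E tE Ex] [E' tE' E'y]; have [F [tF Fx Fy]] := joinP _ _ _ _ tE Ex tE' E'y.
exists (adjoin F x); first exact: tower_step.
by have [] := adjoin_gen x (tower_subring rD tF).
Qed.

Lemma sn_hull_finite C D (s : seq T) : subring D -> (forall x, x \in s -> sn_hull C D x) ->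
  exists2 E, tower C D E & forall x, x \in s -> E x.
Proof.
move=> rD; elim: s => [|x s IH] h; first by exists D => //; left.
have [|E tE Es] := IH; first by move=> y ys; apply: h; rewrite inE ys orbT.
have [|E' tE' E'x] := @sn_hull_tower C D x rD; first by apply: h; rewrite mem_head.
have [F [tF EF E'F]] := tower_join rD tE tE'; exists F => // y.
by rewrite inE => /predU1P[->|/Es/EF //]; apply: E'F.
Qed.

Lemma sn_hull_subring C D : sn_closed C (sn_hull C D).
Proof.
split; first split.
- by move=> E [[[]]].
- by move=> x y hx hy E hE; have [[[_ EB _] _] _] := hE; apply: EB; [apply: hx|apply: hy].
- by move=> x y hx hy E hE; have [[[_ _ EM] _] _] := hE; apply: EM; [apply: hx|apply: hy].
by move=> x Cx hx hy E hE; have [[_ Esn] _] := hE; apply: (Esn _ Cx); [apply: hx|apply: hy].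
Qed.

Lemma adjoin_elementary D x : subring D -> D (x * x) -> D (x * x * x) ->
  elementary D (adjoin D x) [set z | exists2 w, adjoin D x w & z = x * w]
    [set z | exists2 w, adjoin D x w & z = x * x * w].
Proof.
move=> rD Dxx Dxxx; have rA := adjoin_subring rD Dxx.
have [DA Ax] := adjoin_gen x rD.
have mul z : smod (adjoin D x) [set t | exists2 w, adjoin D x w & t = z * w].
  split; first by exists 0; rewrite ?mulr0 //; apply: subring0.
    move=> _ _ [w Aw ->] [w' Aw' ->]; exists (w + w'); last by rewrite mulrDr.
    exact: subringD.
  by move=> d _ Ad [w Aw ->]; exists (d * w); [apply: subringM | rewrite mulrCA].
split=> //.
- split=> //; first by move=> _ [w Aw ->]; apply: subringM.
  move=> _ [_ [a [b [Da Db ->]]] ->].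
  have -> : x * x * (a + b * x) = a * (x * x) + b * (x * x * x).
    by ring.
  by apply: subringD => //; apply: subringM.
- move=> _ _ [w Aw ->] [w' Aw' ->]; exists (w * w'); last by rewrite mulrACA.
  exact: subringM.
by move=> _ [a [b [Da Db ->]]]; exists a => //; exists b; [apply: DA | ring].
Qed.

Lemma tower_descent C D E J K : subring D -> tower C D E -> invp E J K ->
  exists J' K', [/\ invp D J' K', J' `<=` J & K' `<=` K].
Proof.
move=> rD tE; elim: tE J K => [J K iJK|{}E x tE IH _ xx xxx J K iJK]; first by exists J, K; split.
have el := adjoin_elementary (tower_subring rD tE) xx xxx.
have [J1 [K1 [i1 JJ1 KK1]]] := elementary_descent el iJK.
have [J2 [K2 [i2 JJ2 KK2]]] := IH _ _ i1; exists J2, K2.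
by split=> // z; [move/JJ2/JJ1 | move/KK2/KK1].
Qed.

Lemma tower_in C D E : subring C -> D `<=` C -> tower C D E -> E `<=` C.
Proof.
move=> rC DC; elim=> // E' x _ E'C Cx _ _ _ [a [b [/E'C Ca /E'C Cb ->]]].
by apply: subringD => //; apply: subringM.
Qed.

(** Once the finitely many products $x_iy_j$ lie in one tower $F$, the $F$-spans of the $x_i$ and of
    the $y_j$ are inverse to each other, and they descend step by step. *)
Lemma sn_descent D E J K : subring D -> subring E -> D `<=` E -> E `<=` sn_hull E D ->
  invp E J K -> exists J' K', [/\ invp D J' K', J' `<=` J & K' `<=` K].
Proof.
move=> rD rE DE Esn [mJ mK JK /mulset_ord[n [x [y [Jx Ky xy]]]]].
have [|F tF FP] := @sn_hull_finite E D [seq x i * y j | i <- enum 'I_n, j <- enum 'I_n] rD.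
  by move=> _ /allpairsP[[i j] [_ _ ->]]; apply: Esn; apply: JK; [exact: Jx | exact: Ky].
have {}FP i j : F (x i * y j).
  apply: FP; apply: (allpairs_f (fun i j => x i * y j)); exact: mem_enum.
have rF := tower_subring rD tF; have FE := tower_in rE DE tF.
pose gen (z : 'I_n -> T) := [set t | exists2 a : 'I_n -> T,
  (forall i, F (a i)) & t = \sum_i a i * z i].
have genin z i : gen z (z i).
  exists (fun k => (k == i)%:R).
    by move=> k; case: eqP => _; [case: rF | apply: subring0].
  rewrite (bigD1 i) //= eqxx mul1r big1 ?addr0 //.
  by move=> k /negPf->; rewrite mul0r.
have mgen z : smod F (gen z).
  split.
  - exists (fun=> 0); first by move=> _; apply: subring0.
    by rewrite big1 // => i _; rewrite mul0r.
  - move=> _ _ [a Fa ->] [b Fb ->]; exists (fun i => a i + b i).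
      by move=> i; apply: subringD.
    by rewrite -big_split; apply: eq_bigr => i _; rewrite mulrDl.
  move=> d _ Fd [a Fa ->]; exists (fun i => d * a i).
    by move=> i; apply: subringM.
  by rewrite mulr_sumr; apply: eq_bigr => i _; rewrite mulrA.
have subgen L z : smod E L -> (forall i, L (z i)) -> gen z `<=` L.
  move=> mL Lz _ [a Fa ->]; apply: smod_sum (mL) _ => i _.
  by have [_ _ LZ] := mL; apply: LZ => //; apply: FE.
have iF : invp F (gen x) (gen y).
  split=> //; last by rewrite xy; apply: mulset_of_ord.
  move=> _ _ [a Fa ->] [b Fb ->]; rewrite mulr_suml; apply: subring_sum (rF) _ => i _.
  rewrite mulr_sumr; apply: subring_sum (rF) _ => j _.
  by rewrite mulrACA; do !apply: subringM => //.
have [J' [K' [i' J'x K'y]]] := tower_descent rD tF iF; exists J', K'; split=> // z.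
  by move/J'x; apply: subgen.
by move/K'y; apply: subgen.
Qed.

End Towers.

Lemma sn_hull_morph (S T : comPzRingType) (g : {rmorphism S -> T})
    (C D : set S) (C' D' : set T) :
  (forall x, C x -> C' (g x)) -> (forall x, D x -> sn_hull C' D' (g x)) ->
  forall x, sn_hull C D x -> sn_hull C' D' (g x).
Proof.
move=> CC DD x; have [[h1 hB hM] hsn] := sn_hull_subring C' D'.
move: x; apply: (smallest_sub (X := fun x => sn_hull C' D' (g x))) => //; split; first split.
- by rewrite rmorph1.
- by move=> x y hx hy; rewrite rmorphB; apply: hB.
- by move=> x y hx hy; rewrite rmorphM; apply: hM.
move=> x /CC Cx; rewrite !rmorphM; exact: hsn.
Qed.

(** * Exactness of the sequence of a tower *)

Lemma inv_mod_of (R S : comPzRingType) (f : {rmorphism R -> S}) (J K : set S) :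
  invp (range f) J K -> exists X : inv_mod f, inv_set X = J /\ inv_set (- X) = K.
Proof.
move=> iJK; exists (InvMod (invp_invertible iJK)); split=> //.
exact: inv_modN.
Qed.

Section Exactness.
Variables (R S T : comPzRingType).
Variables (f : {rmorphism R -> S}) (g : {rmorphism S -> T}).
Variables (h : {rmorphism R -> T}) (gf : forall r, g (f r) = h r).

Lemma range_tower : range h `<=` range g.
Proof. by move=> _ [r _ <-]; exists (f r); rewrite ?gf. Qed.

Lemma inv_mod_smod (J : inv_mod g) : smod (range g) J.
Proof. by case: (inv_modP J). Qed.

Lemma inv_extend_sub (J : inv_mod h) (L : set T) : smod (range g) L ->
  J `<=` L -> inv_extend gf J `<=` L.
Proof.
move=> mL JL; apply: mod_mul_min; first exact/is_submodE.
by move=> x y /JL Lx gy; rewrite mulrC; have [_ _] := mL; apply.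
Qed.

Lemma inv_extend_sup (J : inv_mod h) : J `<=` inv_extend gf J.
Proof.
move=> x Jx; rewrite -[x]mulr1; apply: mod_mul_in => //.
by have [] := range_subring g.
Qed.

Lemma inv_extendN (J : inv_mod h) : - inv_extend gf J = inv_extend gf (- J).
Proof. by rewrite raddfN. Qed.

Lemma inv_inclN (J : inv_mod f) : - inv_incl gf J = inv_incl gf (- J).
Proof. by rewrite raddfN. Qed.

Lemma inv_extend_eq0 (J : inv_mod h) :
  J `<=` range g -> inv_set (- J) `<=` range g -> inv_extend gf J = 0.
Proof.
move=> Jg NJg; have mg := subring_smod (range_subring g) (@subset_refl _ _).
apply: inv_mod_sub_eq; first exact: inv_extend_sub mg Jg.
rewrite inv_extendN oppr0; exact: inv_extend_sub mg NJg.
Qed.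

(** The descended module and its inverse, extended back to $S$, stay inside $J$ and $J^{-1}$; two
    such inclusions force equality. *)
Lemma inv_extend_surj : range g `<=` sn_hull (range g) (range h) ->
  forall J : inv_mod g, exists J' : inv_mod h, inv_extend gf J' = J.
Proof.
move=> gsn J; have [J1 [K1 [i1 JJ1 KK1]]] := sn_descent (range_subring h)
  (range_subring g) range_tower gsn (inv_modP J).
have [J' [J'E NJ'E]] := inv_mod_of i1; exists J'.
apply: inv_mod_sub_eq.
  by apply: inv_extend_sub (inv_mod_smod J) _; rewrite J'E.
rewrite inv_extendN.
by apply: inv_extend_sub (inv_mod_smod (- J)) _; rewrite NJ'E.
Qed.

Hypothesis g_inj : injective g.

(** The preimages of $J$ and $J^{-1}$ are inverse to each other: the relation $1=\sum x_iy_i$ lifts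
    along the injective map [g]. *)
Lemma inv_incl_onto (J : inv_mod h) :
  J `<=` range g -> inv_set (- J) `<=` range g -> exists J', inv_incl gf J' = J.
Proof.
move=> Jg NJg; have [[J0 JD JZ] [K0 KD KZ] JK JK1] := inv_modP J.
have : invp (range f) (g @^-1` J) (g @^-1` (inv_set (- J))).
  split.
  - split; rewrite /preimage /=; first by rewrite rmorph0.
      by move=> x y Jx Jy; rewrite rmorphD; apply: JD.
    by move=> _ x [r _ <-] Jx; rewrite rmorphM gf; apply: JZ.
  - split; rewrite /preimage /=; first by rewrite rmorph0.
      by move=> x y Jx Jy; rewrite rmorphD; apply: KD.
    by move=> _ x [r _ <-] Jx; rewrite rmorphM gf; apply: KZ.
  - move=> x y Jx Ky; have [r _] := JK _ _ Jx Ky.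
    by rewrite -gf -rmorphM => /g_inj <-; exists r.
  have [n [x [y [Jx Ky xy]]]] := mulset_ord JK1.
  have [x' x'E] : exists x' : 'I_n -> S, forall i, g (x' i) = x i.
    have hx i : {z | g z = x i} by apply: cid; have [z _ zE] := Jg _ (Jx i); exists z.
    by exists (fun i => sval (hx i)) => i; case: (hx i).
  have [y' y'E] : exists y' : 'I_n -> S, forall i, g (y' i) = y i.
    have hy i : {z | g z = y i} by apply: cid; have [z _ zE] := NJg _ (Ky i); exists z.
    by exists (fun i => sval (hy i)) => i; case: (hy i).
  have -> : 1 = \sum_i x' i * y' i.
    apply: g_inj; rewrite rmorph1 rmorph_sum xy; apply: eq_bigr => i _.
    by rewrite rmorphM x'E y'E.
  by apply: mulset_of_ord => i /=; rewrite ?x'E ?y'E; [exact: Jx | exact: Ky].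
move=> /inv_mod_of[J' [J'E _]]; exists J'; apply: inv_mod_eq => /=; rewrite J'E.
apply/seteqP; split=> [_ [x Jx <-]//|x Jx].
by have [z _ zE] := Jg _ Jx; exists z => //; rewrite /preimage /= zE.
Qed.

Lemma tower_short_exact : range g `<=` sn_hull (range g) (range h) ->
  short_exact (inv_incl gf : {additive _ -> _}) (inv_extend gf : {additive _ -> _}).
Proof.
move=> gsn; split.
- move=> J J' /(congr1 (@inv_set _ _ _))/= e; apply: inv_mod_eq.
  apply/seteqP; split=> x Jx.
    have : (g @` J') (g x) by rewrite -e; exists x.
    by move=> [y J'y /g_inj <-].
  have : (g @` J) (g x) by rewrite e; exists x.
  by move=> [y Jy /g_inj <-].
- apply/seteqP; split=> [_ [J _ <-]|J /= J0].
    rewrite /preimage /=; apply: inv_extend_eq0; first by move=> _ [x _ <-]; exists x.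
    by rewrite inv_inclN => _ [x _ <-]; exists x.
  have [||J' <-] := @inv_incl_onto J; last by exists J'.
    by move=> x /inv_extend_sup; rewrite J0.
  by move=> x /inv_extend_sup; rewrite -inv_extendN J0 oppr0.
by apply/seteqP; split=> // J _; have [J' <-] := inv_extend_surj gsn J; exists J'.
Qed.

End Exactness.

(** * Compatibility of base change with the maps of the sequence *)

Section ThetaSquares.
Variables (R S T : comPzRingType).
Variables (f : {rmorphism R -> S}) (g : {rmorphism S -> T}).
Variables (h : {rmorphism R -> T}) (gf : forall r, g (f r) = h r).
Variables (M : conomType) (I : set M).
Let fI : {rmorphism monomial_quot R I -> monomial_quot S I} := monomial_quot_map f I.
Let gI : {rmorphism monomial_quot S I -> monomial_quot T I} := monomial_quot_map g I.
Let hI : {rmorphism monomial_quot R I -> monomial_quot T I} := monomial_quot_map h I.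
Let gfI : forall a, gI (fI a) = hI a := @monomial_quot_map_comp _ _ _ f g h gf M I.

Lemma theta_incl J : inv_incl gfI (theta f I J) = theta h I (inv_incl gf J).
Proof.
(* All maps commute with inversion, so this inclusion for $J$ and for $J^{-1}$ gives equality. *)
suff sub J' : inv_incl gfI (theta f I J') `<=` theta h I (inv_incl gf J').
  apply: inv_mod_sub_eq; first exact: sub.
  by rewrite inv_inclN -!raddfN; exact: sub.
move=> _ [x + <-]; move: x; apply: mod_span_min.
  have [J0 JD JZ] := mod_span_submod hI (@monomial_quot_const T M I @` inv_set (inv_incl gf J')).
  split=> [|x y Jx Jy|r x Jx] /=; first by rewrite rmorph0.
    by rewrite rmorphD; apply: JD.
  by rewrite rmorphM gfI; apply: JZ.
move=> _ [x Jx <-]; apply: mod_sub_span; exists (g x); first by exists x.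
by rewrite [RHS]monomial_quot_map_const.
Qed.

Lemma theta_extend J : inv_extend gfI (theta h I J) = theta g I (inv_extend gf J).
Proof.
suff sub J' : inv_extend gfI (theta h I J') `<=` theta g I (inv_extend gf J').
  apply: inv_mod_sub_eq; first exact: sub.
  by rewrite inv_extendN -!raddfN; exact: sub.
have mL := inv_mod_smod (theta g I (inv_extend gf J')).
apply: inv_extend_sub (mL) _; apply: mod_span_min.
  apply/is_submodE; apply: smod_trans mL; exact: range_tower gfI.
move=> _ [x Jx <-]; apply: mod_sub_span; exists x => //.
exact: inv_extend_sup.
Qed.
End ThetaSquares.

(** * Subintegral extensions are exhausted by towers *)

Section IntegralElements.
Variable T : comPzRingType.
Implicit Types (C D E J K I : set T) (s : seq T).

Definition integral_over E (c : T) : Prop := exists n (a : 'I_n -> T),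
  (forall i, E (a i)) /\ c ^+ n + \sum_(i < n) a i * c ^+ i = 0.

Definition span E s : set T := mulset E (fun x => x \in s).

Lemma span_smod E s : subring E -> smod E (span E s).
Proof. by move=> rE; apply/mulset_smod/(subring_smod rE). Qed.

Lemma span_gen E s x : subring E -> x \in s -> span E s x.
Proof. by move=> [E1 _ _] xs; rewrite -[x]mul1r; apply: mulset_in. Qed.

Lemma span_mul E J s x y : (forall e, E e -> J (x * e)) -> span E s y ->
  mulset J (fun x => x \in s) (x * y).
Proof. by move=> h hy; apply: mulset_dist hy h. Qed.

Lemma span_coef E J s z : smod E J -> mulset J (fun x => x \in s) z ->
  exists a : 'I_(size s) -> T, (forall i, J (a i)) /\
    z = \sum_i a i * tnth (in_tuple s) i.
Proof.
move=> mJ; have [J0 JD JZ] := mJ.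
pose L := [set z | exists a : 'I_(size s) -> T, (forall i, J (a i)) /\
    z = \sum_i a i * tnth (in_tuple s) i].
have mL : smod E L.
  split.
  - by exists (fun=> 0); split=> //; rewrite big1 // => i _; rewrite mul0r.
  - move=> _ _ [a [Ja ->]] [b [Jb ->]]; exists (fun i => a i + b i).
    split=> [i|]; first exact: JD.
    by rewrite -big_split; apply: eq_bigr => i _; rewrite mulrDl.
  move=> d _ Ed [a [Ja ->]]; exists (fun i => d * a i).
  split=> [i|]; first exact: JZ.
  by rewrite mulr_sumr; apply: eq_bigr => i _; rewrite mulrA.
move: z; apply: mulset_min mL _ => x y Jx ys.
have [i ->] : exists i, y = tnth (in_tuple s) i by apply/tnthP.
exists (fun k => if k == i then x else 0); split=> [k|]; first by case: eqP.
rewrite (bigD1 i) //= eqxx big1 ?addr0 // => k /negPf->.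
by rewrite mul0r.
Qed.

Lemma integral_finite E s : subring E -> (forall c, c \in s -> integral_over E c) ->
  exists gs : seq T, [/\ 1 \in gs,
    forall F, subring F -> E `<=` F -> (forall c, c \in s -> F c) ->
      forall x, x \in gs -> F x &
    forall c g, c \in s -> g \in gs -> span E gs (c * g)].
Proof.
move=> rE; elim: s => [_|c s IH intc].
  exists [:: 1]; split=> [|F [F1 _ _] _ _ x|//]; first exact: mem_head.
  by rewrite inE => /eqP->.
have [|gs [g1 gF gst]] := IH; first by move=> x xs; apply: intc; rewrite inE xs orbT.
have [n [a [Ea ca]]] := intc c (mem_head _ _).
(* The exponent $n$ is included so that the list still contains $1$ when $n=0$. *)
pose gs' := [seq g * c ^+ i | g <- gs, i <- iota 0 n.+1].
have in_gs' g i : g \in gs -> (i <= n)%N -> g * c ^+ i \in gs'.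
  by move=> gg ii; apply: (allpairs_f (fun g i => g * c ^+ i)) => //; rewrite mem_iota.
have [S0 SD SZ] := span_smod gs' rE.
exists gs'; split.
- by have := in_gs' 1 0%N g1 isT; rewrite expr0 mulr1.
- move=> F rF EF sF _ /allpairsP[[g i] [gg _ ->]] /=; apply: subringM => //.
    by apply: gF gg => // x xs; apply: sF; rewrite inE xs orbT.
  by apply: subringX => //; apply: sF; rewrite mem_head.
move=> x _ + /allpairsP[[g i] [gg + ->]] /=; rewrite mem_iota ltnS => + /= ii.
rewrite inE => /predU1P[->|xs].
  rewrite mulrCA -exprS; move: ii; rewrite leq_eqVlt => /predU1P[->|ii]; last first.
    by apply: span_gen => //; apply: in_gs'.
  have -> : c ^+ n.+1 = - (\sum_(i < n) a i * c ^+ i.+1).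
    have := congr1 ( *%R c) ca; rewrite mulr0 mulrDr -exprS mulr_sumr => /eqP.
    rewrite addr_eq0 => /eqP->; congr (- _); apply: eq_bigr => k _.
    by rewrite exprS mulrCA.
  rewrite mulrN; apply: smodN (rE) (span_smod gs' rE) _.
  rewrite mulr_sumr; apply: smod_sum (span_smod gs' rE) _ => k _.
  by rewrite mulrCA; apply: SZ => //; apply: span_gen => //; apply: in_gs'.
have [t tP xg] : span E gs (x * g) by apply: gst.
rewrite mulrA xg mulr_suml; apply: smod_sum_seq (span_smod gs' rE) _ => p /tP[Ep pg].
by rewrite -mulrA; apply: SZ => //; apply: span_gen => //; apply: in_gs'.
Qed.

(** [I] is an ideal of [E] only, so congruence is carried together with membership in [E] through
    the Leibniz formula. *)
Lemma det_congr E I n (X Y : 'M[T]_n) : subring E -> smod E I -> I `<=` E ->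
  (forall i j, E (X i j)) -> (forall i j, I (X i j - Y i j)) -> I (\det X - \det Y).
Proof.
move=> rE mI IE EX IXY; have [I0 ID IZ] := mI.
pose K x y := E x /\ I (x - y).
have EY x y : K x y -> E y.
  by move=> [Ex Ixy]; rewrite -[y](subKr x); have [_ EB _] := rE; apply: EB => //; apply: IE.
have KD x y x' y' : K x y -> K x' y' -> K (x + x') (y + y').
  move=> [Ex Ixy] [Ex' Ixy']; split; first exact: subringD.
  by rewrite opprD addrACA; apply: ID.
have KM x y x' y' : K x y -> K x' y' -> K (x * x') (y * y').
  move=> Kxy [Ex' Ixy']; have Ey := EY _ _ Kxy; have [Ex Ixy] := Kxy.
  split; first exact: subringM.
  have -> : x * x' - y * y' = x' * (x - y) + y * (x' - y') by ring.
  by apply: ID; apply: IZ.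
have K0 x : E x -> K x x by move=> Ex; split; rewrite ?subrr.
suff [] : K (\det X) (\det Y) by [].
rewrite /determinant; apply: (big_rec2 K) => [|s x y _ Kxy]; first by apply: K0; apply: subring0.
apply: KD Kxy; apply: (KM).
  by apply: K0; apply: subringX => //; apply: subringN => //; case: rE.
apply: (big_rec2 K) => [|i x' y' _ Kxy']; first by apply: K0; case: rE.
by apply: KM Kxy'.
Qed.

(* Cayley-Hamilton: this replaces lying over. *)
Lemma integral_ideal_radical E I w : subring E -> smod E I -> I `<=` E ->
  (forall c, integral_over E c) -> E w -> mulset I [set: T] w ->
  exists n, I (w ^+ n).
Proof.
move=> rE mI IE intE Ew [t tP wE].
have [|gs [g1 _ gst]] := @integral_finite E (unzip2 t) rE; first by move=> c _; apply: intE.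
have IMs g : g \in gs -> mulset I (fun x => x \in gs) (w * g).
  move=> gg; rewrite wE mulr_suml; rewrite big_seq.
  apply: smod_sum (mulset_smod _ mI) _ => p pt; rewrite -mulrA.
  apply: span_mul (gst _ _ _ gg); last by apply: map_f.
  by move=> e Ee; rewrite mulrC; have [_ _] := mI; apply=> //; case: (tP _ pt).
pose n := size gs; pose g (i : 'I_n) := tnth (in_tuple gs) i.
have [a aP] : exists a : 'I_n -> 'I_n -> T, forall i, (forall j, I (a i j)) /\
    w * g i = \sum_j a i j * g j.
  have h i : {a : 'I_n -> T | (forall j, I (a j)) /\ w * g i = \sum_j a j * g j}.
    by apply: cid; apply: span_coef mI (IMs _ _); apply: mem_tnth.
  by exists (fun i => sval (h i)) => i; case: (h i).
(* $X$ kills the vector of generators, so $\det X$ kills each of them, in particular $1$; and $\det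
   X\equiv w^n$ modulo $I$. *)
pose X : 'M_n := w%:M - \matrix_(i, j) a i j; pose G : 'cV_n := \col_i g i.
have XG : X *m G = 0.
  apply/colP=> i; rewrite mulmxBl mul_scalar_mx !mxE (aP i).2.
  by apply/eqP; rewrite subr_eq0; apply/eqP/eq_bigr => j _; rewrite !mxE.
have detX : \det X = 0.
  have /tnthP[i gi] : 1 \in in_tuple gs by [].
  have : ((\det X)%:M *m G) i 0 = 0 by rewrite -mul_adj_mx -mulmxA XG mulmx0 mxE.
  by rewrite mul_scalar_mx !mxE /g -gi mulr1.
exists n; rewrite -(det_scalar n w) -[\det _]opprK; apply: smodN (rE) (mI) _.
rewrite -sub0r -detX; apply: det_congr (rE) (mI) (IE) _ _ => i j; rewrite !mxE.
  have [_ EB _] := rE; apply: EB; last by apply: IE; case: (aP i).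
  by case: eqP => _; rewrite ?mulr1n // mulr0n; apply: subring0.
rewrite addrAC subrr add0r; apply: smodN (rE) (mI) _.
by case: (aP i).
Qed.

Definition mclosed C : Prop := forall x y, C x -> C y -> C (x * y).

Lemma spec_eq (P Q : Spec T) : (forall x, P x <-> Q x) -> P = Q.
Proof.
case: P Q => [[P iP] P1 PM] [[Q iQ] Q1 QM] /= PQ.
have e : P = Q by apply/funext => x; apply/propext.
subst Q; rewrite (Prop_irrelevance iQ iP) in Q1 QM *.
by rewrite (Prop_irrelevance Q1 P1) (Prop_irrelevance QM PM).
Qed.

Lemma prime_idealX (P : Spec T) x n : P (x ^+ n) -> P x.
Proof.
elim: n => [|n IH]; first by rewrite expr0 => /prime_ideal_proper.
by rewrite exprS => /prime_idealM[].
Qed.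

Lemma prime_avoiding C K : is_ideal K -> C 1 -> mclosed C ->
  (forall x, C x -> K x -> False) ->
  exists P : Spec T, K `<=` P /\ forall x, C x -> ~ P x.
Proof.
move=> iK C1 CM CK.
(* Adding [K] makes the union of the empty chain admissible. *)
pose good (X : set T) := is_ideal (X `|` K) /\ forall x, C x -> ~ (X `|` K) x.
have [|A [[[A0 AD AM] AC] Amax]] := @Zorn_bigcup T good.
  move=> F Fgood Ftot; split; last first.
    by move=> x Cx [[X FX Xx]|]; [case: (Fgood _ FX) => _ /(_ x Cx); apply; left | apply: CK].
  have [K0 KD KM] := iK.
  split; first by right.
    move=> x y [[X FX Xx]|Kx] [[Y FY Yy]|Ky]; last by right; apply: KD.
    - have [Z [FZ XZ YZ]] : exists Z, [/\ F Z, X `<=` Z & Y `<=` Z].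
        by have [XY|YX] := Ftot _ _ FX FY; [exists Y | exists X]; split.
      have [[_ ZD _] _] := Fgood _ FZ.
      have [||Zxy|] := ZD x y; [by left; apply: XZ | by left; apply: YZ | |].
        by left; exists Z.
      by right.
    - have [[_ ZD _] _] := Fgood _ FX.
      by have [||Zxy|] := ZD x y; [left | right | left; exists X | right].
    have [[_ ZD _] _] := Fgood _ FY.
    by have [||Zxy|] := ZD x y; [right | left | left; exists Y | right].
  move=> a x [[X FX Xx]|Kx]; last by right; apply: KM.
  have [[_ _ ZM] _] := Fgood _ FX.
  by have [|Zxy|] := ZM a x; [left | left; exists X | right].
have Aproper : ~ (A `|` K) 1 by apply: AC.
have Aprime x y : (A `|` K) (x * y) -> (A `|` K) x \/ (A `|` K) y.
  move=> Axy; apply: contrapT => /not_orP[Ax Ay].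
  have meet z : ~ (A `|` K) z -> exists q b, (A `|` K) q /\ C (q + b * z).
    move=> Az; pose B := [set t | exists q b, (A `|` K) q /\ t = q + b * z].
    have AB : A `|` K `<=` B by move=> t At; exists t, 0; rewrite mul0r addr0.
    have Bz : B z by exists 0, 1; rewrite mul1r add0r.
    have BK : B `|` K = B by apply/seteqP; split=> t; [case=> // Kt; apply: AB; right | left].
    have /Amax : A `<` B.
      split=> [t At|BA]; first by apply: AB; left.
      by apply: Az; left; apply: BA.
    apply: contra_notP => nC; rewrite /good BK; split; last first.
      by move=> t Ct [q [b [Aq tE]]]; apply: nC; exists q, b; rewrite -tE.
    split; first exact: AB.
      move=> _ _ [q [b [Aq ->]]] [q' [b' [Aq' ->]]]; exists (q + q'), (b + b').
      by split; [apply: AD | ring].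
    move=> d _ [q [b [Aq ->]]]; exists (d * q), (d * b).
    by split; [apply: AM | ring].
  have [q [b [Aq Cq]]] := meet _ Ax; have [q' [b' [Aq' Cq']]] := meet _ Ay.
  apply: (AC _ (CM _ _ Cq Cq')).
  have -> : (q + b * x) * (q' + b' * y) = (q' + b' * y) * q + ((b * x) * q' + (b * b') * (x * y)).
    by ring.
  by apply: (AD); [apply: AM | apply: AD; apply: AM].
exists (PrimeIdeal (prime_ideal := Ideal (And3 A0 AD AM)) Aproper Aprime).
by split=> [x Kx|]; [right | exact: AC].
Qed.

(** A maximal multiplicative set disjoint from [I] stands for the complement of a minimal prime over
    [I]. For $z\in D\setminus C$ the elements $yz^k$ with $y\in C$ form a larger multiplicative set,
    which must meet [I]. *)
Lemma maximal_avoiding D I : subring D -> ~ I 1 -> (forall d x, D d -> I x -> I (d * x)) ->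
  exists C, [/\ C `<=` D, C 1, mclosed C, forall x, C x -> ~ I x &
    forall z, D z -> ~ C z -> exists (x : T) k, C x /\ I (x * z ^+ k)].
Proof.
move=> rD I1 IM.
pose good C := [/\ C `<=` D, mclosed C & forall x, C x -> ~ I x].
have [|C [[CD CM CI] Cmax]] := @Zorn_bigcup T good.
  move=> F Fgood Ftot; split.
  - by move=> x [X FX Xx]; case: (Fgood _ FX) => XD _ _; apply: XD.
  - move=> x y [X FX Xx] [Y FY Yy].
    have [XY|YX] := Ftot _ _ FX FY.
      by exists Y => //; case: (Fgood _ FY) => _ YM _; apply: YM => //; apply: XY.
    by exists X => //; case: (Fgood _ FX) => _ XM _; apply: XM => //; apply: YX.
  by move=> x [X FX Xx]; case: (Fgood _ FX) => _ _ XI; apply: XI.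
have [D1 _ DM] := rD.
have C1 : C 1.
  apply: contrapT => nC1; apply: (Cmax (C `|` [set 1])).
    by split=> [x|h]; [left | apply/nC1/h; right].
  split; first by move=> x [/CD //|->].
    move=> x y [Cx|->] [Cy|->]; rewrite ?mulr1 ?mul1r.
    - by left; apply: CM.
    - by left.
    - by left.
    by right.
  by move=> x [/CI //|->].
exists C; split=> // z Dz nCz; apply: contrapT => nI.
apply: (Cmax [set x | exists (y : T) k, C y /\ x = y * z ^+ k]).
  split=> [x Cx|h]; first by exists x, 0%N; rewrite mulr1.
  by apply/nCz/h; exists 1, 1%N; rewrite mul1r.
split.
- by move=> _ [s [k [Cs ->]]]; apply: DM; [apply: CD | apply: subringX].
- move=> _ _ [s [k [Cs ->]]] [s' [k' [Cs' ->]]]; exists (s * s'), (k + k')%N.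
  by split; [apply: CM | rewrite exprD mulrACA].
by move=> _ [s [k [Cs ->]]] Isz; apply: nI; exists s, k.
Qed.

End IntegralElements.

(** * Seminormal subrings of a subintegral extension *)

Section Swan.
Variables (R T : comPzRingType) (f : {rmorphism R -> T}).

(** The class of [c] in the residue field is the image of a fraction $a/b$; clear the
    denominator. *)
Lemma residue_surj (Q : Spec T) c : bijective (residue_map f Q) ->
  exists a b : R, ~ Q (f b) /\ Q (f b * c - f a).
Proof.
case=> inv _ invK; pose y : residue_domain Q := quot_proj Q c.
have := invK (FracField.tofrac y); move: (inv _) => x.
elim/frac_ind: x => a b b0; rewrite /residue_map frac_mapE //.
have fb0 := frac_map_neq0 (@residue_domain_map_inj _ _ f Q) b0.
rewrite -[RHS]divr1 -(tofrac1 (residue_domain Q)).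
move=> /eqP; rewrite eqr_div ?tofrac_neq0 ?oner_neq0 //.
rewrite tofrac1 mulr1 -tofracM tofrac_eq => /eqP.
move: b0 fb0; elim/quot_ind: a => a; elim/quot_ind: b => b b0 fb0.
have mapE r : residue_domain_map (quot_proj (contraction f Q) r) = quot_proj Q (f r).
  exact: quotr_mapE.
rewrite -[GRing.RMorphism.sort _ _]/(residue_domain_map _) mapE.
rewrite -[GRing.RMorphism.sort _ _ in RHS]/(residue_domain_map _) mapE.
rewrite -[RHS](rmorphM (quot_proj Q)) => /quot_projP Qac.
exists a, b; split.
  move=> Qfb; move/eqP: b0; apply; rewrite -[0](raddf0 (quot_proj (contraction f Q))).
  by apply/quot_projP; rewrite subr0.
have [_ _ QM] := idealP Q.
by have := QM (-1) _ Qac; rewrite mulN1r opprB mulrC.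
Qed.

(* C is the complement of a prime of D minimal over the conductor I of D in E = *)
(* D[c].  If Q is a prime lying over it and z = f(b) c - f(a) is in Q, then z is *)
(* nilpotent modulo I up to a factor in C, since Q is the only prime over its   *)
(* trace; as I is radical, s c is in D for some s in C, and then a power of s   *)
(* is in I.                                                                     *)
Lemma seminormal_full (D : set T) : integral_extension f ->
  injective (contraction f) -> (forall Q : Spec T, bijective (residue_map f Q)) ->
  sn_closed [set: T] D -> range f `<=` D -> forall c, D c.
Proof.
move=> intf injf resf [rD Dsn] fD c; apply: contrapT => nDc.
have [D1 DB DM] := rD.
have intD x : integral_over D x.
  have [n [a ax]] := intf x; exists n, (fun i => f (a i)); split=> // i.
  by apply: fD; exists (a i).
have [|gs [g1 gsF gst]] := @integral_finite T D [:: c] rD; first by move=> x _; apply: intD.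
pose E : set T := smallest (@subring T) (D `|` [set c]).
have rE : subring E.
  split=> [F [[]]//|x y hx hy F hF|x y hx hy F hF]; have [[_ FB FM] _] := hF.
    by apply: FB; [apply: hx | apply: hy].
  by apply: FM; [apply: hx | apply: hy].
have DE : D `<=` E by move=> x Dx; apply: sub_gen_smallest; left.
have Ec : E c by apply: sub_gen_smallest; right.
have mspan := span_smod gs rD.
have [S0 SD SZ] := mspan.
have Espan : E `<=` span D gs.
  suff h : E `<=` [set x | forall y, span D gs y -> span D gs (x * y)].
    by move=> x /h hx; rewrite -[x]mulr1; apply/hx/span_gen.
  apply: smallest_sub => /=; first split.
  - by move=> y; rewrite mul1r.
  - move=> x y hx hy z Sz; rewrite mulrBl; apply: SD; first exact: hx.
    by apply: smodN (rD) (mspan) _; apply: hy.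
  - by move=> x y hx hy z Sz; rewrite -mulrA; apply/hx/hy.
  move=> t [Dt y|->]; first exact: SZ.
  move=> y [s sP ->]; rewrite mulr_sumr; apply: smod_sum_seq (mspan) _ => p /sP[Dp pg].
  by rewrite mulrCA; apply: SZ => //; apply: gst => //; apply: mem_head.
(* $E$ lies in a finitely generated $D$-module with generators in $E$, so a single power of $d$
   suffices. *)
have power d : D d -> D (d * c) -> exists n, forall e, E e -> D (d ^+ n * e).
  move=> Dd Ddc.
  have Epow : E `<=` [set e | exists n, D (d ^+ n * e)].
    apply: smallest_sub => /=; first split.
    - by exists 0%N; rewrite mulr1.
    - move=> x y [n Dx] [m Dy]; exists (n + m)%N.
      have -> : d ^+ (n + m) * (x - y) = d ^+ m * (d ^+ n * x) - d ^+ n * (d ^+ m * y).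
        by rewrite exprD; ring.
      by apply: DB; apply: DM => //; apply: subringX.
    - move=> x y [n Dx] [m Dy]; exists (n + m)%N.
      by rewrite exprD mulrACA; apply: DM.
    by move=> t [Dt|->]; [exists 0%N; rewrite mul1r | exists 1%N].
  have [n Dn] : exists n, forall g, g \in gs -> D (d ^+ n * g).
    have {}gsE g : g \in gs -> E g.
      by apply: gsF => // x; rewrite inE => /eqP->.
    elim: (gs) gsE => [|g s IH] sE; first by exists 0%N.
    have [|n Dn] := IH; first by move=> x xs; apply: sE; rewrite inE xs orbT.
    have [m Dm] := Epow _ (sE _ (mem_head _ _)); exists (m + n)%N => x.
    rewrite inE exprD => /predU1P[->|xs].
      by rewrite mulrAC mulrC; apply: DM => //; apply: subringX.
    by rewrite -mulrA; apply: DM; [apply: subringX | apply: Dn].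
  exists n => e /Espan [s sP ->]; rewrite mulr_sumr.
  apply: smod_sum_seq (subring_smod rD (@subset_refl _ D)) _ => p /sP[Dp pg].
  by rewrite mulrCA; apply: DM => //; apply: Dn.
clearbody E.
pose I : set T := [set x | E x /\ forall e, E e -> D (x * e)].
have ID : I `<=` D by move=> x [_ h]; rewrite -[x]mulr1; apply: h; case: rE.
have IE : I `<=` E by move=> x [].
have mI : smod E I.
  split.
  - by split; [apply: subring0 | move=> e _; rewrite mul0r; apply: subring0].
  - move=> x y [Ex Dx] [Ey Dy]; split; first exact: subringD.
    by move=> e Ee; rewrite mulrDl; apply: subringD (rD) _ _; [apply: Dx | apply: Dy].
  move=> d x Ed [Ex Dx]; split; first exact: subringM.
  by move=> e Ee; rewrite mulrAC mulrC; apply: Dx; apply: subringM.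
have [I0 _ IZ] := mI.
have nI1 : ~ I 1 by move=> [_ /(_ c Ec)]; rewrite mul1r.
(* The conductor is radical by seminormality: for $e\in E$, the square and the cube of $ye$ are
   $E$-multiples of $y^2$, hence in $D$. *)
have Isqr y : E y -> I (y * y) -> I y.
  move=> Ey [_ Dyy]; split=> // e Ee; apply: Dsn => //.
    by rewrite mulrACA; apply: Dyy; apply: subringM.
  have -> : y * e * (y * e) * (y * e) = y * y * (y * (e * e * e)) by ring.
  by apply: Dyy; do !apply: subringM => //.
have Irad y k : E y -> I (y ^+ k) -> I y.
  move=> Ey; elim: k => [//|[|k] IH Iyk] //; apply: IH; apply: Isqr; first exact: subringX.
  have -> : y ^+ k.+1 * y ^+ k.+1 = y ^+ k * y ^+ k.+2.
    by rewrite -!exprD !addSn !addnS.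
  by apply: IZ => //; apply: subringX.
have [C [CD C1 CM CI Cmax]] := maximal_avoiding rD nI1
  (fun d x Dd => IZ d x (DE d Dd)).
pose K := mulset I [set: T].
have iK : is_ideal K.
  have [K0 KD _] := mulset_smod [set: T] mI; split=> // a x Kx.
  by rewrite mulrC; have [s sP ->] := Kx; rewrite mulr_suml;
    apply: smod_sum_seq (mulset_smod [set: T] mI) _ => p /sP[Ip _];
    rewrite -mulrA; apply: mulset_in.
have IK : I `<=` K by move=> x Ix; rewrite -[x]mulr1; apply: mulset_in.
have intE x : integral_over E x.
  by have [n [a [Da ax]]] := intD x; exists n, a; split=> // i; apply: DE.
have KE w : E w -> K w -> exists n, I (w ^+ n).
  exact: integral_ideal_radical.
have CX x n : C x -> C (x ^+ n).
  by move=> Cx; elim: n => [//|n IH]; rewrite exprS; apply: CM.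
have CE x : C x -> E x by move/CD/DE.
have [|Q [KQ CQ]] := prime_avoiding iK C1 CM.
  by move=> x Cx /(KE _ (CE _ Cx))[n]; apply: CI; apply: CX.
(* Maximality of [C] fixes the trace on $D$ of every such prime; with injectivity of the map on
   spectra, there is only one. *)
have trace (P : Spec T) : K `<=` P -> (forall x, C x -> ~ P x) ->
    forall d, D d -> P d <-> ~ C d.
  move=> KP CP d Dd; split=> [Pd /CP //|nCd].
  have [x [k [Cx /IK/KP]]] := Cmax _ Dd nCd.
  by move=> /prime_idealM[/(CP _ Cx) //|]; apply: prime_idealX.
have fD' r : D (f r) by apply: fD; exists r.
have [a [b [nQb Qbc]]] := residue_surj c (resf Q).
have Cb : C (f b) by apply: contrapT => /(trace _ KQ CQ _ (fD' b)).
pose z := f b * c - f a.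
have Ez : E z by have [_ EB _] := rE; apply: EB; [apply: subringM => //|]; apply: DE.
(* Otherwise some prime over [K] avoids [C] and all powers of $z$; it equals $Q$ by the uniqueness
   just noted, yet $z\in Q$. *)
have [x [k [Cx Kxz]]] : exists (x : T) k, C x /\ K (x * z ^+ k).
  apply: contrapT => nK.
  pose C' := [set t | exists (x : T) k, C x /\ t = x * z ^+ k].
  have [|||Q' [KQ' CQ']] := @prime_avoiding T C' K iK.
  - by exists 1, 0%N; rewrite mulr1.
  - move=> _ _ [x [k [Cx ->]]] [y [l [Cy ->]]]; exists (x * y), (k + l)%N.
    by rewrite exprD mulrACA; split=> //; apply: CM.
  - by move=> _ [x [k [Cx ->]]] Kx; apply: nK; exists x, k.
  have CQ'' x : C x -> ~ Q' x.
    by move=> Cx; apply: CQ'; exists x, 0%N; rewrite mulr1.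
  have QQ' : Q = Q'.
    apply: injf; apply: spec_eq => r /=.
    by rewrite (trace _ KQ CQ _ (fD' r)) (trace _ KQ' CQ'' _ (fD' r)).
  apply: (CQ' z); first by exists 1, 1%N; rewrite mul1r.
  by rewrite -QQ'.
have Exz : E (x * z) by apply: subringM => //; apply: CE.
have [m Im] : exists m, I ((x * z ^+ k) ^+ m).
  by apply: KE => //; apply: subringM => //; [apply: CE | apply: subringX].
have Ixz : I (x * z).
  apply: (Irad _ (k * m + m)%N) => //.
  have -> : (x * z) ^+ (k * m + m) = (x ^+ (k * m) * z ^+ m) * (x * z ^+ k) ^+ m.
    by rewrite !exprMn exprM !exprD -!exprM; ring.
  by apply: IZ => //; apply: subringM => //; apply: subringX => //; apply: CE.
have Cxb : C (x * f b) by apply: CM.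
have [|n Dn] := power _ (CD _ Cxb).
  have -> : x * f b * c = x * z + x * f a by rewrite /z; ring.
  by apply: subringD (rD) (ID _ Ixz) _; apply: DM => //; apply: CD.
apply: (CI _ (CX _ n Cxb)); split; last exact: Dn.
by apply: subringX => //; apply: CE.
Qed.

Lemma subintegral_sn_hull : subintegral f -> forall c, sn_hull [set: T] (range f) c.
Proof.
move=> [_ intf bijf resf]; apply: seminormal_full => //; first exact: bij_inj.
  exact: sn_hull_subring.
exact: sub_gen_smallest.
Qed.
End Swan.

(** * The exponential isomorphism *)

Section ElementaryUnits.
Variables (S T : comPzRingType) (g : {rmorphism S -> T}) (D1 N c : set T).
Let D : set T := range g.
Hypothesis el : elementary D D1 N c.

Let exp_set n : set T := [set z | exists a b, [/\ D a, c b & z = a * (1 + n) + b]].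

Let rD : subring D. Proof. by case: el => -[]. Qed.
Let rD1 : subring D1. Proof. by case: el => -[]. Qed.
Let mN : smod D1 N. Proof. by case: el => _ []. Qed.
Let mc : smod D1 c. Proof. by case: el => _ []. Qed.
Let DD1 : D `<=` D1. Proof. by case: el => _ _ []. Qed.
Let ND1 : N `<=` D1. Proof. by case: el => _ _ []. Qed.
Let cD : c `<=` D. Proof. by case: el => _ _ []. Qed.
Let NN x y : N x -> N y -> c (x * y). Proof. by case: el => _ _ _ h _; apply: h. Qed.
Let NNn x : N x -> N (- x). Proof. exact: smodN rD1 mN. Qed.
Let D1n x : N x -> D1 (1 + x).
Proof. by move=> /ND1; apply: subringD => //; case: rD1. Qed.

Let exp_c n : c `<=` exp_set n.
Proof. by move=> b cb; exists 0, b; rewrite mul0r add0r; split=> //; apply: subring0. Qed.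

Let exp_1 n : exp_set n (1 + n).
Proof.
by exists 1, 0; rewrite mul1r addr0; split=> //; [case: rD | case: mc].
Qed.

Let exp_sub n L : smod D L -> L (1 + n) -> c `<=` L -> exp_set n `<=` L.
Proof.
move=> [_ LD LZ] L1 cL _ [a [b [Da /cL Lb ->]]].
by apply: LD => //; apply: LZ.
Qed.

Let exp_smod n : smod D (exp_set n).
Proof.
have [c0 cA cZ] := smod_trans DD1 mc.
split; first exact: exp_c.
  move=> _ _ [a [b [Da cb ->]]] [a' [b' [Da' cb' ->]]]; exists (a + a'), (b + b').
  by split; [apply: subringD | apply: cA | ring].
move=> d _ Dd [a [b [Da cb ->]]]; exists (d * a), (d * b).
by split; [apply: subringM | apply: cZ | ring].
Qed.

(** $(1+n)(1+m)=1+(n+m)+nm$ with $nm\in c$: modulo $c$ this is the exponential law. *)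
Let exp_mul n m : N n -> N m -> forall x y, exp_set n x -> exp_set m y -> exp_set (n + m) (x * y).
Proof.
move=> Nn Nm _ _ [a [b [Da cb ->]]] [a' [b' [Da' cb' ->]]].
have [c0 cA cZ] := mc.
exists (a * a'), ((a * a') * (n * m) + (a * (1 + n) * b' + (a' * (1 + m) * b + b * b'))).
split; [exact: subringM | | ring].
have Dn := D1n Nn; have Dm := D1n Nm.
do !apply: (cA); apply: cZ => //; try exact: NN; do ?apply: subringM => //; try exact: DD1.
by apply/DD1/cD.
Qed.

Let exp_set0 n : D n -> exp_set n `<=` D.
Proof.
move=> Dn; apply: exp_sub; [exact: subring_smod| |exact: cD].
by apply: subringD => //; case: rD.
Qed.

Let exp_invp n : N n -> invp D (exp_set n) (exp_set (- n)).
Proof.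
move=> Nn; split; try exact: exp_smod.
  move=> x y nx ny; have := exp_mul Nn (NNn Nn) nx ny; rewrite subrr.
  by apply: exp_set0; apply: subring0.
have [_ PD PZ] := mulset_smod (exp_set (- n)) (exp_smod n).
have cnn := NN Nn Nn.
(* $(1+n)(1-n)$ falls short of $1$ by $n^2\in c$; the other two products, with factors in $c$, make
   it up. *)
have -> : 1 = (1 + n) * (1 - n) + ((1 + n) * (n * n) * (1 - n) + (n * n) * (n * n)) by ring.
have cnn' : c ((1 + n) * (n * n)) by have [_ _] := mc; apply=> //; apply: D1n.
apply: (PD); first by apply: mulset_in.
apply: PD; first by apply: mulset_in => //; apply: exp_c.
by apply: mulset_in; apply: exp_c.
Qed.

(* In the model case, the D-module (1 + n) D + c represents exp(n).          *)
Lemma elementary_iso : exists eps : T -> inv_mod g,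
  [/\ forall x y, D1 x -> D1 y -> eps (x + y) = eps x + eps y,
      forall x, D1 x -> eps x = 0 <-> D x,
      forall x, D1 x -> eps x `<=` D1 /\ inv_set (- eps x) `<=` D1 &
      forall J : inv_mod g, J `<=` D1 -> inv_set (- J) `<=` D1 ->
        exists2 x, D1 x & eps x = J].
Proof.
have [E EP] : exists E : T -> inv_mod g, forall n, N n ->
    inv_set (E n) = exp_set n /\ inv_set (- E n) = exp_set (- n).
  have h n : {X : inv_mod g | N n -> inv_set X = exp_set n /\ inv_set (- X) = exp_set (- n)}.
    apply: cid; have [Nn|nNn] := pselect (N n); last by exists 0.
    by have [X XE] := inv_mod_of (exp_invp Nn); exists X.
  by exists (fun n => sval (h n)) => n; case: (h n).
have EN n : N n -> inv_set (E n) = exp_set n by move/EP => [].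
have ED n m : N n -> N m -> E (n + m) = E n + E m.
  move=> Nn Nm; have Nnm : N (n + m) by case: mN => _ NA _; apply: NA.
  apply/esym/inv_mod_sub_eq.
    rewrite inv_mod_addE !EN //; apply: mulset_min (exp_smod _) _; exact: exp_mul.
  rewrite opprD inv_mod_addE (EP _ Nn).2 (EP _ Nm).2 (EP _ Nnm).2 opprD.
  by apply: mulset_min (exp_smod _) _; apply: exp_mul; apply: NNn.
have E0 n : N n -> E n = 0 <-> D n.
  move=> Nn; split=> [E0|Dn].
    have : exp_set n (1 + n) by [].
    rewrite -EN // E0 => h.
    by rewrite -[n](addKr 1) addrC; have [D1' DB _] := rD; apply: DB.
  apply: inv_mod_sub_eq; first by rewrite EN //; apply: exp_set0.
  by rewrite oppr0 (EP _ Nn).2; apply: exp_set0; apply: subringN.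
(* [d] is an arbitrary choice of component in $D$. It is determined up to $D\cap N$, on which [E]
   vanishes, so [eps] is additive although [d] may not be. *)
have [d dP] : exists d : T -> T, forall x, D1 x -> D (d x) /\ N (x - d x).
  have h x : {d | D1 x -> D d /\ N (x - d)}.
    apply: cid; have [D1x|] := pselect (D1 x); last by exists 0.
    by have [_ _ _ _ D1N] := el; have [d Dd Nd] := D1N _ D1x; exists d.
  by exists (fun x => sval (h x)) => x; case: (h x).
exists (fun x => E (x - d x)); split.
- move=> x y Dx Dy; have [Ddx Nx] := dP _ Dx; have [Ddy Ny] := dP _ Dy.
  have [Dd Nd] := dP _ (subringD rD1 Dx Dy).
  rewrite -ED //; pose t := d x + d y - d (x + y).
  have tE : x + y - d (x + y) = (x - d x + (y - d y)) + t by rewrite /t; ring.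
  have [_ NA _] := mN; have Nxy := NA _ _ Nx Ny.
  have Nt : N t.
    by rewrite -[t](addKr (x - d x + (y - d y))) -tE addrC; apply: NA => //; apply: NNn.
  rewrite tE ED // (E0 _ Nt).2 ?addr0 //.
  by have [_ DB _] := rD; apply: DB => //; apply: subringD.
- move=> x Dx; have [Ddx Nx] := dP _ Dx; rewrite E0 //; split=> h.
    by rewrite -[x](subrK (d x)); apply: subringD.
  by have [_ DB _] := rD; apply: DB.
- have sub n : N n -> exp_set n `<=` D1.
    move=> Nn; apply: exp_sub; first exact: subring_smod.
      exact: D1n.
    by move=> x /cD/DD1.
  move=> x Dx; have [Ddx Nx] := dP _ Dx; rewrite EN // (EP _ Nx).2.
  by split; apply: sub => //; apply: NNn.
move=> J JD1 KD1; have iJ := inv_modP J.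
(* Replacing each $y_i$ in $1=\sum x_iy_i$ by its component in $D$ gives an element of $A$ that
   differs from $1$ by an element of $N$. *)
have one_in (A B : set T) : invp D A B -> A `<=` D1 -> B `<=` D1 -> exists2 n, N n & A (1 + n).
  move=> [mA mB AB /mulset_ord[k [x [y [Ax By xy]]]]] AD1 BD1.
  have [e eP] : exists e : 'I_k -> T, forall i, D (e i) /\ N (y i - e i).
    by exists (fun i => d (y i)) => i; apply/dP/BD1/By.
  exists (- \sum_i x i * (y i - e i)).
    apply: NNn; apply: smod_sum (mN) _ => i _; have [_ _ NZ] := mN.
    by apply: NZ; [apply: AD1 | case: (eP i)].
  rewrite {1}xy -sumrB; apply: smod_sum (mA) _ => i _.
  rewrite -mulrBr subKr mulrC; have [_ _ AZ] := mA.
  by apply: AZ => //; case: (eP i).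
have c_in (A B : set T) : invp D A B -> A `<=` D1 -> B `<=` D1 -> c `<=` A.
  move=> [mA mB AB [s sP s1]] AD1 BD1 b cb; rewrite -[b]mulr1 s1 mulr_sumr.
  apply: smod_sum_seq (mA) _ => p /sP[Ap Bp]; rewrite mulrCA mulrC.
  have [_ _ AZ] := mA; apply: AZ => //; apply: cD; rewrite mulrC.
  by have [_ _ cZ] := mc; apply: cZ => //; apply: BD1.
have [n Nn Jn] := one_in _ _ iJ JD1 KD1.
have [m Nm Km] := one_in _ _ (invp_sym iJ) KD1 JD1.
have Dnm : D (n + m).
  have -> : n + m = (1 + n) * (1 + m) - (1 + n * m) by ring.
  have [D1' DB _] := rD; have [_ _ JK _] := iJ.
  by apply: DB; [apply: JK | apply: subringD => //; apply/cD/NN].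
have Em : E m = - E n.
  by apply/eqP; rewrite -addr_eq0 addrC -ED //; apply/eqP/E0 => //; case: mN => _ NA _; apply: NA.
have EnJ : E n = J.
  apply: inv_mod_sub_eq.
    rewrite EN //; apply: exp_sub => //; first by case: iJ.
    exact: c_in iJ JD1 KD1.
  rewrite -Em EN //; apply: exp_sub => //; first by case: iJ.
  exact: c_in (invp_sym iJ) KD1 JD1.
exists n; first exact: ND1.
have [Dd Nd] := dP _ (ND1 Nn); rewrite -EnJ -[in RHS](subrK (d n) n).
have Ndn : N (d n).
  have -> : d n = n - (n - d n) by rewrite subKr.
  by have [_ NA _] := mN; apply: NA => //; apply: NNn.
by rewrite [in RHS]ED // (E0 _ Ndn).2 ?addr0.
Qed.

End ElementaryUnits.

Lemma Zorn_above (X : Type) (good : set (set X)) (G0 : set X) : good G0 ->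
  (forall F : set (set X), F `<=` good -> (exists G, F G) -> total_on F subset ->
    good (\bigcup_(G in F) G)) ->
  exists G, [/\ good G, G0 `<=` G & forall H, G `<=` H -> good H -> H `<=` G].
Proof.
move=> good0 good_cup.
have [|A [Agood Amax]] := @Zorn_bigcup X (fun G => good (G `|` G0)).
  move=> F Fgood Ftot; have [[G FG]|F0] := pselect (exists G, F G); last first.
    suff -> : \bigcup_(G in F) G `|` G0 = G0 by [].
    by apply/seteqP; split=> [x [[G FG]|//]|x G0x]; [case: F0; exists G | right].
  have -> : \bigcup_(G in F) G `|` G0 = \bigcup_(G in [set H `|` G0 | H in F]) G.
    apply/seteqP; split=> [x [[H FH Hx]|G0x]|x [_ [H FH <-]] [Hx|G0x]].
    - by exists (H `|` G0); [exists H | left].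
    - by exists (G `|` G0); [exists G | right].
    - by left; exists H.
    - by right.
  apply: good_cup; first by move=> _ [H /Fgood gH <-].
    by exists (G `|` G0); exists G.
  move=> _ _ [H FH <-] [K FK <-].
  by have [HK|KH] := Ftot _ _ FH FK; [left|right]; apply: setSU.
exists (A `|` G0); split=> // H AH gH.
apply: contrapT => nHA; apply: (Amax H).
  by split=> [x Ax|HA]; [apply: AH; left | apply: nHA => x /HA; left].
suff -> : H `|` G0 = H by [].
by apply/seteqP; split=> x; [case=> // G0x; apply: AH; right | left].
Qed.

Lemma int_subgroup_principal (H : set int) : H 0 ->
  (forall m n, H m -> H n -> H (m - n)) ->
  exists n : nat, H n%:Z /\ forall m, H m -> exists q, m = q * n%:Z.
Proof.
move=> H0 HB.
have HN m : H m -> H (- m) by move=> Hm; rewrite -sub0r; apply: HB.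
have HD m n : H m -> H n -> H (m + n).
  by move=> Hm Hn; rewrite -[n]opprK; apply: HB => //; apply: HN.
have [ex|nex] := pselect (exists n, (0 < n)%N && `[< H n%:Z >]); last first.
  exists 0%N; split=> // m Hm; exists 0; rewrite mul0r.
  apply/eqP; apply: contrapT => /negP m0; apply: nex; exists `|m|%N.
  rewrite absz_gt0 m0; apply/asboolP; case: m Hm {m0} => k // /HN.
  by rewrite NegzE opprK.
case: (ex_minnP ex) => n /andP[n0 /asboolP Hn] nmin; exists n; split=> // m Hm.
have HM (q : int) : H (q * n%:Z).
  have HMn (k : nat) : H (k%:Z * n%:Z).
    elim: k => [|k IH]; first by rewrite mul0r.
    by rewrite intS mulrDl mul1r; apply: HD.
  by case: q => k; [apply: HMn | rewrite NegzE mulNr; apply/HN/HMn].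
exists (m %/ n%:Z)%Z; rewrite {1}(divz_eq m n%:Z).
have n0' : n%:Z != 0 by rewrite eqz_nat -lt0n.
suff -> : (m %% n%:Z)%Z = 0 by rewrite addr0.
have Hr : H (m %% n%:Z)%Z by rewrite /modz; apply: HB.
have := modz_ge0 m n0'; have := ltz_mod m n0'.
case: (modz m n) Hr => // k Hk; rewrite ger0_norm // ltz_nat => kn _.
have [->//|k0] := posnP k.
by have := nmin k; rewrite k0 /= leqNgt kn; move=> /(_ (asboolT Hk)).
Qed.

Lemma sn_hull_mono (T : comPzRingType) (C C' D : set T) :
  C `<=` C' -> sn_hull C D `<=` sn_hull C' D.
Proof.
move=> CC x; apply: (sn_hull_morph (g := idfun) CC) => y Dy.
exact: sub_gen_smallest.
Qed.

(** * Gluing exponentials along towers *)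

Section ExponentialIso.
Variables (R T : comPzRingType) (u : {rmorphism R -> T}).
Implicit Types (G H : set (T * inv_mod u)).

Definition dom G : set T := [set x | exists J, G (x, J)].

Definition subgraph G : Prop := G (0, 0) /\
  forall x y J K, G (x, J) -> G (y, K) -> G (x - y, J - K).

(* G is the graph of an isomorphism from dom G / range u to the subgroup of     *)
(* the invertible modules contained in dom G together with their inverses; the *)
(* hull condition makes invertible modules descend from dom G to range u.      *)
Definition partial_iso G : Prop :=
  [/\ subgraph G, subring (dom G) /\ range u `<=` dom G,
      dom G `<=` sn_hull (dom G) (range u),
      forall x J, G (x, J) -> range u x <-> J = 0 &
      forall J : inv_mod u, (J `<=` dom G /\ inv_set (- J) `<=` dom G) <-> exists x, G (x, J)].

Lemma subgraphD G x y J K : subgraph G -> G (x, J) -> G (y, K) -> G (x + y, J + K).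
Proof.
move=> [G0 GB] Gx Gy; rewrite -[y]opprK -[K]opprK; apply: (GB) => //.
by rewrite -(sub0r y) -(sub0r K); apply: GB.
Qed.

Lemma subgraphMz G x J (m : int) : subgraph G -> G (x, J) -> G (x *~ m, J *~ m).
Proof.
move=> sG Gx; have [G0 GB] := sG.
have GMn (k : nat) : G (x *+ k, J *+ k).
  elim: k => [|k IH]; first by rewrite !mulr0n.
  by rewrite !mulrS; apply: subgraphD.
case: m => k; first exact: GMn.
by rewrite NegzE !mulrNz -!pmulrn -(sub0r (x *+ _)) -(sub0r (J *+ _)); apply: GB.
Qed.

(** The $x_i$ generate $J$ and the $y_i$ generate $K$, so containment in [C] is tested on finitely
    many elements. This is what lets partial isomorphisms pass to unions of chains. *)
Lemma inv_mod_generated (C : set T) (J K : set T) (s : seq (T * T)) :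
  subring C -> range u `<=` C -> invp (range u) J K ->
  1 = \sum_(p <- s) p.1 * p.2 -> (forall p, p \in s -> J p.1 /\ K p.2) ->
  (forall p, p \in s -> C p.1 /\ C p.2) -> J `<=` C /\ K `<=` C.
Proof.
move=> rC uC [_ _ JK _] s1 sJK sC; split=> z hz; rewrite -[z]mulr1 s1 mulr_sumr;
  apply: smod_sum_seq (subring_smod rC (@subset_refl _ C)) _ => p ps;
  have [Jp Kp] := sJK _ ps; have [Cp1 Cp2] := sC _ ps.
  rewrite mulrCA; apply: subringM => //; apply/uC; exact: JK.
by rewrite mulrA; apply: subringM => //; apply/uC; rewrite mulrC; apply: JK.
Qed.

Lemma partial_iso_base : partial_iso [set p | range u p.1 /\ p.2 = 0].
Proof.
set G := [set p | _]; have ru := range_subring u.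
have domG : dom G = range u.
  by apply/seteqP; split=> [x [J []]//|x ux]; exists 0.
split; rewrite ?domG //.
- split; first by split=> //; apply: subring0.
  by move=> x y J K [ux /= ->] [uy /= ->]; rewrite subrr; split=> //; have [_ + _] := ru; apply.
- by split.
- by move=> x; apply: sub_gen_smallest.
- by move=> x J [ux /= ->].
move=> J; split=> [[Ju NJu]|[x [ux J0]]].
  exists 0; split; first exact: subring0.
  by apply: inv_mod_sub_eq => //; rewrite oppr0.
by have J0' : J = 0 by []; rewrite J0' oppr0; split.
Qed.

Lemma partial_iso_cup (F : set (set (T * inv_mod u))) :
  F `<=` partial_iso -> (exists G, F G) -> total_on F subset ->
  partial_iso (\bigcup_(G in F) G).
Proof.
move=> FP [G0 FG0] Ftot; set U := \bigcup_(G in F) G.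
have two p q : U p -> U q -> exists G, [/\ F G, G p & G q].
  move=> [G FG Gp] [H FH Hq]; have [GH|HG] := Ftot _ _ FG FH.
    by exists H; split=> //; apply: GH.
  by exists G; split=> //; apply: HG.
have domU G : F G -> dom G `<=` dom U by move=> FG x [J Gx]; exists J, G.
have dom2 x y : dom U x -> dom U y -> exists G, [/\ F G, dom G x & dom G y].
  by move=> [J Ux] [K Uy]; have [G [FG Gx Gy]] := two _ _ Ux Uy;
    exists G; split=> //; [exists J | exists K].
have rU : subring (dom U).
  split.
  - by have [_ [[D1 _ _] _] _ _ _] := FP _ FG0; apply: domU FG0 _ D1.
  - move=> x y /dom2 h /h[G [FG Gx Gy]]; have [_ [[_ DB _] _] _ _ _] := FP _ FG.
    by apply: domU FG _ _; apply: DB.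
  - move=> x y /dom2 h /h[G [FG Gx Gy]]; have [_ [[_ _ DM] _] _ _ _] := FP _ FG.
    by apply: domU FG _ _; apply: DM.
have uU : range u `<=` dom U.
  by have [_ [_ uG] _ _ _] := FP _ FG0; move=> x /uG; apply: domU.
split=> //.
- split; first by exists G0 => //; have [[]] := FP _ FG0.
  move=> x y J K Ux Uy; have [G [FG Gx Gy]] := two _ _ Ux Uy.
  by exists G => //; have [[_ GB] _ _ _ _] := FP _ FG; apply: GB.
- move=> x [J [G FG Gx]]; have [_ _ Gsn _ _] := FP _ FG.
  by apply: (sn_hull_mono (domU _ FG)); apply: Gsn; exists J.
- by move=> x J [G FG Gx]; have [_ _ _ Gk _] := FP _ FG; apply: Gk.
move=> J; split=> [[JU KU]|[x [G FG Gx]]]; last first.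
  have [_ _ _ _ Gr] := FP _ FG; have [|JG KG] := (Gr J).2; first by exists x.
  by split=> z; [move/JG | move/KG]; apply: domU.
have iJ := inv_modP J; have [_ _ _ [s sJK s1]] := iJ.
have [G FG sG] : exists2 G, F G & forall p, p \in s -> dom G p.1 /\ dom G p.2.
  have : forall p, p \in s -> dom U p.1 /\ dom U p.2.
    by move=> p /sJK[/JU ? /KU].
  elim: (s) => [|p t IH] tU; first by exists G0.
  have [|G FG tG] := IH; first by move=> q qt; apply: tU; rewrite inE qt orbT.
  have [[J1 [G1 FG1 Gp1]] [J2 [G2 FG2 Gp2]]] := tU p (mem_head _ _).
  have [G' [FG' GG' [G1' G2']]] : exists G', [/\ F G', G `<=` G' & G1 `<=` G' /\ G2 `<=` G'].
    have [H [FH GH G1H]] : exists H, [/\ F H, G `<=` H & G1 `<=` H].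
      by have [h|h] := Ftot _ _ FG FG1; [exists G1 | exists G]; split.
    have [h|h] := Ftot _ _ FH FG2; [exists G2 | exists H]; do 2?split=> //.
    - by move=> z /GH/h.
    - by move=> z /G1H/h.
  exists G' => // q; rewrite inE => /predU1P[->|/tG[[K1 h1] [K2 h2]]].
    by split; [exists J1; apply: G1' | exists J2; apply: G2'].
  by split; [exists K1; apply: GG' | exists K2; apply: GG'].
have [_ [rG uG] _ _ Gr] := FP _ FG.
have [x Gx] : exists x, G (x, J) by apply/Gr; apply: inv_mod_generated s1 sJK sG.
by exists x, G.
Qed.

Hypothesis Qalg : forall n, exists r : R, r * n.+1%:R = 1.

Lemma divideQ (C : set T) n x : subring C -> range u `<=` C -> C x ->
  exists2 y, C y & y *+ n.+1 = x.
Proof.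
move=> rC uC Cx; have [r rn] := Qalg n; exists (u r * x).
  by apply: subringM => //; apply: uC; exists r.
rewrite -mulrnAl -rmorphMn; have -> : r *+ n.+1 = 1 by rewrite -mulr_natr.
by rewrite rmorph1 mul1r.
Qed.

(** With $D_1=D[x]$, [G] gives $D/R\cong\mathcal I(R,D)$ and [eps] gives $D_1/D\cong\mathcal
    I(D,D_1)$. A homomorphism from $D_1$ extending [G] and lifting [eps] through [rho] is then an
    isomorphism on $D_1/R$. It exists because $\ker\rho\cong D/R$ is divisible: Zorn's lemma,
    extending to one element at a time. *)
Lemma partial_iso_extend G x : partial_iso G -> dom G (x * x) -> dom G (x * x * x) ->
  exists H, [/\ partial_iso H, G `<=` H & dom H x].
Proof.
move=> [sG [rD uD] Dsn Gker Gran] Dxx Dxxx; set D := dom G in rD uD Dsn Gran Dxx Dxxx.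
have DB a b : D a -> D b -> D (a - b) by case: rD => _ + _; apply.
have DM a b : D a -> D b -> D (a * b) by case: rD => _ _; apply.
pose Di := @Intermediate R T u D (fun r => uD _ (ex_intro2 _ _ r I erefl)) DB DM.
pose w : {rmorphism R -> int_ring Di} := int_incl Di.
pose g : {rmorphism int_ring Di -> T} := @int_val _ _ _ Di.
pose gw : forall r, g (w r) = u r := @int_inclK _ _ _ Di.
have rangeg : range g = D.
  apply/seteqP; split=> [_ [y _ <-]|y Dy]; first by have /asboolP := valP y.
  by exists (Sub y (asboolT Dy)) => //; apply: SubK.
pose rho : {additive inv_mod u -> inv_mod g} := inv_extend gw.
have rho_surj J : exists J', rho J' = J.
  by apply: inv_extend_surj; rewrite rangeg.
have rho0 J : rho J = 0 <-> exists y, G (y, J).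
  rewrite -Gran; split=> [J0|[JD KD]]; last by apply: inv_extend_eq0; rewrite rangeg.
  split=> z /(@inv_extend_sup _ _ _ _ _ _ gw).
    by rewrite -[inv_extend _ _]/(rho J) J0 -rangeg.
  by rewrite -[inv_extend _ _]/(rho (- J)) raddfN J0 oppr0 -rangeg.
pose D1 := adjoin D x.
have rD1 : subring D1 := adjoin_subring rD Dxx.
have [DD1 D1x] : D `<=` D1 /\ D1 x := adjoin_gen x rD.
have uD1 : range u `<=` D1 by move=> z /uD/DD1.
have D1sn : D1 `<=` sn_hull D1 (range u).
  have sub z : D z -> sn_hull D1 (range u) z by move/Dsn; apply: sn_hull_mono.
  have [hr hsn] := sn_hull_subring D1 (range u).
  move=> _ [a [b [Da Db ->]]].
  apply: (subringD hr); [exact: sub | apply: (subringM hr); first exact: sub].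
  by apply: hsn => //; apply: sub.
have el := adjoin_elementary rD Dxx Dxxx; rewrite -rangeg in el.
have [eps [epsD eps0 epsS epsJ]] := elementary_iso el.
rewrite rangeg -/D1 in eps0 el epsS epsJ epsD; clearbody D1.
have epsB a b : D1 a -> D1 b -> eps (a - b) = eps a - eps b.
  move=> Da Db; apply: (addIr (eps b)); rewrite -epsD ?subrK //.
  by have [_ B1 _] := rD1; apply: B1.
have epsz : eps 0 = 0 by apply/eps0; apply: subring0.
have epsMn a k : D1 a -> eps (a *+ k) = eps a *+ k /\ D1 (a *+ k).
  move=> Da; elim: k => [|k [IH Dk]]; first by rewrite !mulr0n; split=> //; apply: subring0.
  by rewrite !mulrS epsD // IH; split=> //; apply: subringD.
have epsMz a (m : int) : D1 a -> eps (a *~ m) = eps a *~ m /\ D1 (a *~ m).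
  move=> Da; case: m => k; first exact: epsMn.
  have [ek Dk] := epsMn _ k.+1 Da; rewrite NegzE !mulrNz -!pmulrn; split; last exact: subringN.
  by rewrite -[- _]sub0r epsB ?epsz ?ek ?sub0r //; apply: subring0.
pose good H := [/\ subgraph H, G `<=` H,
  forall a J, H (a, J) -> D1 a /\ rho J = eps a &
  forall a J, H (a, J) -> range u a <-> J = 0].
have [||H [[sH GH Heps Hker] _ Hmax]] := @Zorn_above _ good G.
- split=> // a J Ga; have Da : D a by exists J.
  have D1a := DD1 _ Da; split=> //.
  by rewrite (eps0 _ D1a).2 //; apply/rho0; exists a.
- move=> F Fgood [G0 FG0] Ftot; split.
  + split; first by exists G0 => //; have [[]] := Fgood _ FG0.
    move=> a b J K [A FA Aa] [B FB Bb]; have [AB|BA] := Ftot _ _ FA FB.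
      by exists B => //; have [[_ BB] _ _ _] := Fgood _ FB; apply: BB => //; apply: AB.
    by exists A => //; have [[_ AA] _ _ _] := Fgood _ FA; apply: AA => //; apply: BA.
  + by move=> p Gp; exists G0 => //; have [_ + _ _] := Fgood _ FG0; apply.
  + by move=> a J [A FA Aa]; have [_ _ + _] := Fgood _ FA; apply.
  by move=> a J [A FA Aa]; have [_ _ _] := Fgood _ FA; apply.
have [H0 HB] := sH.
have Htot a : D1 a -> dom H a.
  move=> D1a; have [||n [[J Hna] nP]] := @int_subgroup_principal [set m | dom H (a *~ m)].
  - by exists 0; rewrite mulr0z.
  - by move=> m k [J Hm] [K Hk]; exists (J - K); rewrite mulrzBr; apply: HB.
  have [K0 K0a] := rho_surj (eps a).
  (* For any lift [K0] of [eps a], $nK_0-J$ lies in $\ker\rho$, so it is the value of [G] at some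
     $d$; subtracting the value at $d/n$ corrects the lift. For $n=0$ any lift works, since then
     $J=0$. *)
  have [K rhoK nK] : exists2 K, rho K = eps a & K *~ n%:Z = J.
    case: n Hna nP => [|n] Hna nP.
      exists K0 => //; rewrite mulr0z; apply/esym; apply: (Hker _ _ Hna).1.
      by rewrite mulr0z; exists 0; rewrite ?rmorph0.
    have [d Gd] : exists d, G (d, K0 *+ n.+1 - J).
      apply/rho0; rewrite raddfB raddfMn /= K0a (Heps _ _ Hna).2.
      by rewrite -pmulrn (epsMn _ n.+1 D1a).1 subrr.
    have [d' [K1 Gd'] d'E] : exists2 d', D d' & d' *+ n.+1 = d.
      by apply: divideQ => //; exists (K0 *+ n.+1 - J).
    have nK1 : K1 *+ n.+1 = K0 *+ n.+1 - J.
      apply/eqP; rewrite -subr_eq0; apply/eqP.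
      have [_ GB] := sG.
      have := GB _ _ _ _ (subgraphMz n.+1%:Z sG Gd') Gd.
      rewrite -!pmulrn d'E subrr => /Gker[+ _]; apply.
      by exists 0; rewrite ?rmorph0.
    exists (K0 - K1).
      rewrite raddfB /= K0a (rho0 K1).2 ?subr0 //; by exists d'.
    by rewrite -pmulrn mulrnBl nK1 subKr.
  pose H' := [set p | exists b J' (m : int), H (b, J') /\ p = (b + a *~ m, J' + K *~ m)].
  have Hm m : dom H (a *~ m) -> H (a *~ m, K *~ m).
    move=> /nP[q ->]; rewrite [q * _]mulrC !mulrzA.
    by apply: subgraphMz (sH) _; rewrite nK.
  suff gH' : good H'.
    exists K; apply: (Hmax H') => //.
      by move=> [b J'] Hb; exists b, J', 0; rewrite !mulr0z !addr0.
    by exists 0, 0, 1; rewrite !add0r !mulr1z.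
  split.
  - split; first by exists 0, 0, 0; rewrite !mulr0z !addr0.
    move=> _ _ _ _ [b [J1 [m [Hb [-> ->]]]]] [b' [J2 [m' [Hb' [-> ->]]]]].
    exists (b - b'), (J1 - J2), (m - m'); split; first exact: HB.
    by rewrite !mulrzBr !opprD; congr (_, _); rewrite addrACA.
  - by move=> [b J'] /GH Hb; exists b, J', 0; rewrite !mulr0z !addr0.
  - move=> _ _ [b [J1 [m [Hb [-> ->]]]]]; have [Db rhoJ1] := Heps _ _ Hb.
    have [em Dm] := epsMz _ m D1a.
    split; first exact: subringD.
    by rewrite raddfD raddfMz /= rhoJ1 rhoK epsD // em.
  move=> _ _ [b [J1 [m [Hb [-> ->]]]]]; have [Db rhoJ1] := Heps _ _ Hb.
  have [em Dm] := epsMz _ m D1a.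
  (* Either condition puts $b+ma$ in $D$, so $ma$ is already in the domain of [H], where the kernel
     is known. *)
  suff : (range u (b + a *~ m) -> dom H (a *~ m)) /\ (J1 + K *~ m = 0 -> dom H (a *~ m)).
    move=> [h1 h2]; split=> h.
      by apply: (Hker (b + a *~ m) _ _).1 => //; apply: subgraphD (sH) Hb _; apply/Hm/h1.
    apply: (Hker _ (J1 + K *~ m) _).2 => //; apply: subgraphD (sH) Hb _; exact/Hm/h2.
  have DH z : D (b + z) -> dom H z.
    move=> [L Gbz]; exists (L - J1); rewrite -[z](addKr b) addrC.
    by apply: HB Hb; apply: GH.
  split; first by move/uD/DH.
  move=> JK0; apply: DH; apply/eps0; first exact: subringD.
  have : rho (J1 + K *~ m) = 0 by rewrite JK0 raddf0.
  by rewrite raddfD raddfMz /= rhoJ1 rhoK epsD // em.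
have domH : dom H = D1 by apply/seteqP; split=> [a [J /Heps[]]//|a /Htot].
exists H; split=> //; last by rewrite domH.
split=> //; rewrite ?domH //.
move=> J; split=> [[JD1 KD1]|[a Ha]].
  have mD1 : smod (range g) D1 by rewrite rangeg; apply: subring_smod.
  have [||a D1a epsa] := epsJ (rho J).
  - exact: inv_extend_sub.
  - by rewrite -raddfN; apply: inv_extend_sub.
  have [K Ha] := Htot _ D1a.
  have [d Gd] : exists d, G (d, J - K).
    by apply/rho0; rewrite raddfB /= (Heps _ _ Ha).2 epsa subrr.
  by exists (d + a); rewrite -[J](subrK K); apply: subgraphD => //; apply: GH.
have [D1a rhoJ] := Heps _ _ Ha; have [eD NeD] := epsS _ D1a.
split=> z /(@inv_extend_sup _ _ _ _ _ _ gw).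
  by rewrite -[inv_extend _ _]/(rho J) rhoJ; apply: eD.
by rewrite -[inv_extend _ _]/(rho (- J)) raddfN rhoJ; apply: NeD.
Qed.

Theorem exponential_iso : (forall x, sn_hull [set: T] (range u) x) ->
  exists k : T -> inv_mod u, [/\ forall x y, k (x + y) = k x + k y,
    forall x, k x = 0 <-> range u x & forall J, exists x, k x = J].
Proof.
move=> Tsn; have [G [Giso _ Gmax]] := Zorn_above partial_iso_base partial_iso_cup.
have [sG [rD uD] _ Gker Gran] := Giso; have [G00 GB] := sG.
(* By maximality the domain absorbs every element whose square and cube it contains, hence contains
   the hull. *)
have Gtot x : dom G x.
  apply: Tsn; split=> //; split=> // y _ Dyy Dyyy.
  have [H [Hiso GH [J Hy]]] := partial_iso_extend Giso Dyy Dyyy.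
  by exists J; apply: Gmax Hy.
have Guniq x J K : G (x, J) -> G (x, K) -> J = K.
  move=> GJ GK; have := GB _ _ _ _ GJ GK; rewrite subrr => /Gker[h _].
  by apply/eqP; rewrite -subr_eq0; apply/eqP/h; exists 0; rewrite ?rmorph0.
have [k kP] : exists k : T -> inv_mod u, forall x, G (x, k x).
  by exists (fun x => sval (cid (Gtot x))) => x; case: (cid _).
exists k; split.
- by move=> x y; apply: (Guniq (x + y)) => //; apply: subgraphD.
- by move=> x; have [h1 h2] := Gker _ _ (kP x); split.
move=> J; have [x Gx] : exists x, G (x, J) by apply/Gran; split=> z _; apply: Gtot.
by exists x; apply: Guniq Gx.
Qed.

End ExponentialIso.

(** * Monomial quotients and tensor products *)

Lemma monomial_quotX (R : comPzRingType) (M : conomType) (I : set M) r x :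
  quot_proj (monomial_ideal R I) << r *g x >> =
  monomial_quot_const I r * quot_proj (monomial_ideal R I) << 1 *g x >>.
Proof.
rewrite /monomial_quot_const -rmorphM; congr quot_proj.
by rewrite -[_ * _]/(ma_mul _ _) ma_mulUU mulr1 mul1m.
Qed.

Lemma monomial_quot_mapU (R S : comPzRingType) (f : {rmorphism R -> S})
    (M : conomType) (I : set M) r x :
  monomial_quot_map f I (quot_proj (monomial_ideal R I) << r *g x >>) =
  quot_proj (monomial_ideal S I) << f r *g x >>.
Proof. by rewrite /monomial_quot_map quotr_mapE; congr quot_proj; apply: ma_mapU. Qed.

(** Coefficients lie in the hull because hulls are functorial, and monomials come from the smaller
    algebra; together they generate. *)
Lemma monomial_sn_hull (R S : comPzRingType) (f : {rmorphism R -> S})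
    (M : conomType) (I : set M) :
  (forall s, sn_hull [set: S] (range f) s) ->
  forall z, sn_hull [set: monomial_quot S I] (range (monomial_quot_map f I)) z.
Proof.
move=> Ssn; have [rU _] := sn_hull_subring [set: monomial_quot S I] (range (monomial_quot_map f I)).
elim/quot_ind; apply: ma_ind => [|a b ha hb|r x].
- by rewrite raddf0; apply: subring0.
- by rewrite raddfD; apply: (subringD rU).
rewrite monomial_quotX; apply: (subringM rU); last first.
  apply: sub_gen_smallest; exists (quot_proj (monomial_ideal R I) << 1 *g x >>) => //.
  by rewrite [LHS]monomial_quot_mapU rmorph1.
have := Ssn r; apply: (sn_hull_morph (g := @monomial_quot_const S M I)) => // _ [t _ <-].
apply: sub_gen_smallest; exists (monomial_quot_const I t) => //.
exact: monomial_quot_map_const.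
Qed.

Lemma tower_sn_hull (R S T : comPzRingType) (f : {rmorphism R -> S}) (g : {rmorphism S -> T})
    (h : {rmorphism R -> T}) : (forall r, g (f r) = h r) ->
  (forall s, sn_hull [set: S] (range f) s) -> range g `<=` sn_hull (range g) (range h).
Proof.
move=> gf Ssn _ [s _ <-]; have := Ssn s; apply: sn_hull_morph => [x _|_ [r _ <-]].
  by exists x.
by apply: sub_gen_smallest; exists r; rewrite ?gf.
Qed.

(** * Additive maps on monoid algebras and tensor products *)

Section SupportSums.
Variables (K : choiceType) (V G : zmodType) (F : K -> V -> G).
Hypothesis FD : forall x r s, F x (r + s) = F x r + F x s.

Definition supp_sum (a : {malg V[K]}) : G := \sum_(x <- msupp a) F x a@_x.

Let F0 x : F x 0 = 0.
Proof. by apply: (addIr (F x 0)); rewrite -FD addr0 add0r. Qed.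

Lemma supp_sumw (d : {fset K}) (a : {malg V[K]}) : (msupp a `<=` d)%fset ->
  supp_sum a = \sum_(x <- d) F x a@_x.
Proof.
move=> ad; rewrite /supp_sum (big_fset_incl _ ad) //= => x _ /mcoeff_outdom->.
exact: F0.
Qed.

Lemma supp_sumD a b : supp_sum (a + b) = supp_sum a + supp_sum b.
Proof.
rewrite (supp_sumw (msuppD_le a b)) (supp_sumw (fsubsetUl _ (msupp b))).
rewrite (supp_sumw (fsubsetUr (msupp a) _)) -big_split; apply: eq_bigr => x _.
by rewrite mcoeffD FD.
Qed.

Lemma supp_sumU r x : supp_sum << r *g x >> = F x r.
Proof. by rewrite (supp_sumw msuppU_le) big_seq_fset1 mcoeffUU. Qed.

Lemma supp_sum0 : supp_sum 0 = 0.
Proof. by rewrite /supp_sum msupp0 big_seq_fset0. Qed.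

Lemma supp_sumN a : supp_sum (- a) = - supp_sum a.
Proof. by apply/eqP; rewrite -addr_eq0 -supp_sumD addNr supp_sum0. Qed.

End SupportSums.

Section TensorTheory.
Variables U V : zmodType.

Definition tens (x : U) (y : V) : tensor U V := \pi_(tensor U V)%qT << (x, y) >>.

Lemma tensor_piP (a b : {malg int[(U * V)%type]}) :
  \pi_(tensor U V)%qT a = \pi_(tensor U V)%qT b <->
  smallest (@is_subgroup {malg int[(U * V)%type]}) (@bilinear_relations U V) (a - b).
Proof.
split=> [/eqP|h].
  by rewrite -Quotient.idealrBE => /asboolP.
by apply/eqP; rewrite -Quotient.idealrBE; apply/asboolP.
Qed.

Lemma tensDl x x' y : tens (x + x') y = tens x y + tens x' y.
Proof.
rewrite /tens -raddfD; apply/tensor_piP; apply: sub_gen_smallest; left.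
by exists x, x', y; rewrite opprD addrA.
Qed.

Lemma tensDr x y y' : tens x (y + y') = tens x y + tens x y'.
Proof.
rewrite /tens -raddfD; apply/tensor_piP; apply: sub_gen_smallest; right.
by exists x, y, y'; rewrite opprD addrA.
Qed.

Lemma tens0l y : tens 0 y = 0.
Proof. by apply: (addIr (tens 0 y)); rewrite -tensDl addr0 add0r. Qed.

Lemma tens0r x : tens x 0 = 0.
Proof. by apply: (addIr (tens x 0)); rewrite -tensDr addr0 add0r. Qed.

Lemma tensNl x y : tens (- x) y = - tens x y.
Proof. by apply/eqP; rewrite -addr_eq0 -tensDl addNr tens0l. Qed.

Lemma tensNr x y : tens x (- y) = - tens x y.
Proof. by apply/eqP; rewrite -addr_eq0 -tensDr addNr tens0r. Qed.

Lemma tensMz x y (m : int) : tens (x *~ m) y = tens x (y *~ m).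
Proof.
have tMn (k : nat) : tens (x *+ k) y = tens x (y *+ k).
  by elim: k => [|k IH]; rewrite ?mulr0n ?tens0l ?tens0r // !mulrS tensDl tensDr IH.
case: m => k; first exact: tMn.
by rewrite NegzE !mulrNz -!pmulrn tensNl tensNr tMn.
Qed.

Lemma tensor_ind (P : tensor U V -> Prop) : P 0 ->
  (forall s t, P s -> P t -> P (s - t)) -> (forall x y, P (tens x y)) -> forall t, P t.
Proof.
move=> P0 PB Pt; elim/quotW => a.
have PN s : P s -> P (- s) by move=> Ps; rewrite -sub0r; apply: PB.
have PD s t : P s -> P t -> P (s + t).
  by move=> Ps Pt'; rewrite -[t]opprK; apply: PB => //; apply: PN.
rewrite [a]monalgE raddf_sum; apply: (big_ind P) => // -[x y] _.
move: (a@_(x, y)) => m.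
have Pn (k : nat) : P (\pi_(tensor U V)%qT << k%:Z *g (x, y) >>).
  elim: k => [|k IH]; first by rewrite monalgU0 raddf0.
  by rewrite intS monalgUD raddfD; apply: PD => //; exact: Pt.
case: m => k; first exact: Pn.
by rewrite NegzE monalgUN raddfN; apply/PN/Pn.
Qed.

Lemma tensor_lift (G : zmodType) (h : U -> V -> G) :
  (forall x x' y, h (x + x') y = h x y + h x' y) ->
  (forall x y y', h x (y + y') = h x y + h x y') ->
  exists L : tensor U V -> G, (forall s t, L (s + t) = L s + L t) /\
    forall x y, L (tens x y) = h x y.
Proof.
move=> hl hr; pose F (p : U * V) (m : int) := h p.1 p.2 *~ m.
have FD p m n : F p (m + n) = F p m + F p n by apply: mulrzDr.
pose L0 := supp_sum F.
have LU x y : L0 << (x, y) >> = h x y by rewrite /L0 supp_sumU // /F mulr1z.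
have LB a b : L0 (a - b) = L0 a - L0 b by rewrite /L0 supp_sumD // supp_sumN.
have Lrel : smallest (@is_subgroup {malg int[(U * V)%type]}) (@bilinear_relations U V)
    `<=` [set a | L0 a = 0].
  apply: smallest_sub => /=.
    split; first exact: supp_sum0.
    by move=> a b /= La Lb; rewrite LB La Lb subrr.
  move=> _ [[x [x' [y ->]]]|[x [y [y' ->]]]]; rewrite /= !LB !LU.
    by rewrite hl addrAC addrK subrr.
  by rewrite hr addrAC addrK subrr.
have Lpi a : L0 (repr (\pi_(tensor U V)%qT a)) = L0 a.
  apply/eqP; rewrite -subr_eq0 -LB; apply/eqP/Lrel/tensor_piP.
  by rewrite reprK.
exists (fun t => L0 (repr t)); split; last by move=> x y; rewrite Lpi.
elim/quotW=> a; elim/quotW=> b; rewrite -raddfD !Lpi.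
by rewrite /L0 supp_sumD.
Qed.

End TensorTheory.

(** Both targets are the quotient of [X] by the common kernel. *)
Lemma additive_bijection (X U V : zmodType) (a : X -> U) (b : X -> V) :
  (forall x y, a (x + y) = a x + a y) -> (forall x y, b (x + y) = b x + b y) ->
  (forall x, a x = 0 <-> b x = 0) ->
  (forall w, exists x, a x = w) -> (forall w, exists x, b x = w) ->
  exists h : {additive U -> V}, bijective h.
Proof.
move=> aD bD ab a_surj b_surj.
have morphB (W : zmodType) (c : X -> W) : (forall x y, c (x + y) = c x + c y) ->
    forall x y, c (x - y) = c x - c y.
  by move=> cD x y; apply: (addIr (c y)); rewrite -cD !subrK.
have eq_ab x y : a x = a y <-> b x = b y.
  have aB := morphB _ _ aD; have bB := morphB _ _ bD.
  split=> e; apply/eqP; rewrite -subr_eq0 -?aB -?bB; apply/eqP/ab.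
    by rewrite aB e subrr.
  by rewrite bB e subrr.
pose s w := sval (cid (a_surj w)); have sK w : a (s w) = w by rewrite /s; case: cid.
pose t w := sval (cid (b_surj w)); have tK w : b (t w) = w by rewrite /t; case: cid.
have hB : zmod_morphism (b \o s).
  by move=> x y /=; rewrite -(morphB _ _ bD); apply/eq_ab; rewrite (morphB _ _ aD) !sK.
pose h : {additive U -> V} := HB.pack (b \o s) (GRing.isZmodMorphism.Build _ _ _ hB).
exists h, (a \o t) => x /=; last by rewrite -[RHS]tK; apply/eq_ab; rewrite sK.
by rewrite -[RHS]sK; apply/eq_ab; rewrite tK.
Qed.

Section MonomialTensor.
Variables (R S : comPzRingType) (u : {rmorphism R -> S}) (G : zmodType).
Variables (M : conomType) (I : set M) (k : S -> G).
Hypothesis I_ideal : monoid_ideal I.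
Hypothesis kD : forall x y, k (x + y) = k x + k y.
Hypothesis k_ker : forall x, k x = 0 <-> range u x.
Hypothesis k_surj : forall w, exists x, k x = w.

Let Z := monomial_quot int I.
Let monom x : Z := quot_proj (monomial_ideal int I) << 1 *g x >>.

(* Z is free over the monomials outside I, so the coefficients k(a_x) with x  *)
(* not in I can be read off the tensor sum of the x (x) k(a_x).               *)
Lemma monomial_tensor : exists t : monomial_quot S I -> tensor Z G,
  [/\ forall x y, t (x + y) = t x + t y,
      forall x, t x = 0 <-> range (monomial_quot_map u I) x &
      forall w, exists x, t x = w].
Proof.
have k0 : k 0 = 0 by apply: (addIr (k 0)); rewrite -kD addr0 add0r.
have monom0 x : I x -> monom x = 0.
  move=> Ix; rewrite /monom -[RHS](raddf0 (quot_proj (monomial_ideal int I))).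
  apply/quot_projP; rewrite subr0; apply: sub_gen_smallest; by exists x.
pose F x (r : S) : tensor Z G := tens (monom x) (k r).
have FD x r s : F x (r + s) = F x r + F x s by rewrite /F kD tensDr.
pose t0 := supp_sum F.
have t0B a b : t0 (a - b) = t0 a - t0 b by rewrite /t0 supp_sumD // supp_sumN.
have t0I a : monomial_ideal S I a -> t0 a = 0.
  move=> /(monomial_idealP I_ideal) aI; rewrite /t0 /supp_sum big_seq big1 // => x.
  by rewrite -mcoeff_neq0 => /aI Ix; rewrite /F monom0 // tens0l.
pose t (z : monomial_quot S I) := t0 (repr z).
have tE a : t (quot_proj (monomial_ideal S I) a) = t0 a.
  by apply/eqP; rewrite -subr_eq0 -t0B; apply/eqP/t0I/quot_projP; rewrite quot_projK.
have tD x y : t (x + y) = t x + t y.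
  elim/quot_ind: x => x; elim/quot_ind: y => y.
  by rewrite -raddfD !tE /t0 supp_sumD.
have t_0 : t 0 = 0.
  by rewrite -[0](raddf0 (quot_proj (monomial_ideal S I))) tE /t0 supp_sum0.
have tN x : t (- x) = - t x by apply/eqP; rewrite -addr_eq0 -tD addNr t_0.
have rU := range_subring (monomial_quot_map u I).
exists t; split=> [|z|w]; first exact: tD.
  split=> [|[b _ <-]]; last first.
    elim/quot_ind: b; apply: ma_ind => [|a b ha hb|r x].
    - by rewrite !raddf0.
    - by rewrite !raddfD tD ha hb addr0.
    rewrite [monomial_quot_map _ _ _]monomial_quot_mapU tE /t0 supp_sumU // /F.
    by rewrite (k_ker _).2 ?tens0r //; exists r.
  elim/quot_ind: z => a; rewrite tE => t0a.
  have ka y : ~ I y -> range u a@_y.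
    (* The coefficient at $y$ is well defined on the quotient because $y\notin I$; the induced map
       $z\otimes w\mapsto\mathrm{cf}(z)w$ sends the tensor sum to $k(a_y)$. *)
    move=> nIy; apply/k_ker; pose cf (z : Z) : int := (repr z : {malg int[M]})@_y.
    have cfE b : cf (quot_proj (monomial_ideal int I) b) = b@_y.
      have /quot_projP/(monomial_idealP I_ideal) h :=
        quot_projK (quot_proj (monomial_ideal int I) b).
      apply/eqP; rewrite -subr_eq0 /cf -mcoeffB; apply: contrapT => /negP nz.
      by apply: nIy; apply: h.
    have cfD z z' : cf (z + z') = cf z + cf z'.
      elim/quot_ind: z => z; elim/quot_ind: z' => z'.
      by rewrite -raddfD !cfE mcoeffD.
    have [|| L [LD LE]] := @tensor_lift Z G G (fun z w => w *~ cf z).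
    - by move=> z z' w; rewrite cfD mulrzDr.
    - by move=> z w w'; rewrite mulrzDl.
    have L0 : L 0 = 0 by apply: (addIr (L 0)); rewrite -LD addr0 add0r.
    rewrite -L0 -t0a /t0 /supp_sum.
    rewrite (big_morph L LD L0).
    have [ya|ya] := boolP (y \in msupp a); last first.
      rewrite mcoeff_outdom // k0 big_seq big1 // => x xa.
      rewrite LE cfE mcoeffU; case: eqP => [xy|_]; last by rewrite mulr0n mulr0z.
      by move: ya; rewrite -xy xa.
    rewrite (big_fsetD1 y ya) [X in _ = X + _]LE cfE mcoeffUU mulr1z big_seq.
    rewrite big1 => [|x]; first by rewrite addr0.
    rewrite in_fsetD1 => /andP[/negPf xy _].
    by rewrite LE cfE mcoeffU xy mulr0n mulr0z.
  have ux x : range (monomial_quot_map u I)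
      (quot_proj (monomial_ideal S I) << a@_x *g x >>).
    have [Ix|nIx] := pselect (I x).
      exists 0 => //; rewrite raddf0; apply/esym.
      rewrite monomial_quotX -[RHS](mulr0 (monomial_quot_const I a@_x)).
      congr (_ * _); rewrite -[RHS](raddf0 (quot_proj (monomial_ideal S I))).
      by apply/quot_projP; rewrite subr0; apply: sub_gen_smallest; exists x.
    have [r _ ra] := ka _ nIx; exists (quot_proj (monomial_ideal R I) << r *g x >>) => //.
    by rewrite -ra; apply: monomial_quot_mapU.
  rewrite [a]monalgE raddf_sum; apply: subring_sum (rU) _ => x _; exact: ux.
elim/tensor_ind: w => [|_ _ [x <-] [y <-]|z w]; first by exists 0.
  by exists (x - y); rewrite tD tN.
elim/quot_ind: z; apply: ma_ind => [|a b [x xE] [y yE]|m x].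
- by exists 0; rewrite raddf0 tens0l.
- by exists (x + y); rewrite tD raddfD tensDl xE yE.
have [c cE] := k_surj (w *~ m).
exists (quot_proj (monomial_ideal S I) << c *g x >>).
have mE : monom x *~ m = quot_proj (monomial_ideal int I) << m *g x >>.
  by rewrite monomial_quotX -[in RHS](intz m) rmorph_int mulrzl.
have -> : t (quot_proj (monomial_ideal S I) << c *g x >>) = tens (monom x) (k c).
  by rewrite tE; apply: supp_sumU.
by rewrite cE -tensMz mE.
Qed.

End MonomialTensor.

(** Both groups are images of $S[M]/IS[M]$ with kernel the image of $R[M]/IR[M]$: one by the
    exponential for the monomial quotients, the other by the exponential for $R\subset S$ applied to
    coefficients. *)
Lemma inv_mod_tensor (R S : comPzRingType) (u : {rmorphism R -> S})
    (M : conomType) (I : set M) :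
  monoid_ideal I -> (forall n, exists r : R, r * n.+1%:R = 1) ->
  (forall s, sn_hull [set: S] (range u) s) ->
  let uI : {rmorphism monomial_quot R I -> monomial_quot S I} := monomial_quot_map u I in
  exists h : {additive inv_mod uI -> tensor (monomial_quot int I) (inv_mod u)}, bijective h.
Proof.
move=> I_ideal RQ Ssn uI.
have RIQ n : exists r : monomial_quot R I, r * n.+1%:R = 1.
  have [r rn] := RQ n; exists (monomial_quot_const I r).
  by rewrite -(rmorph_nat (@monomial_quot_const R M I)) -rmorphM rn rmorph1.
have [k [kD k_ker k_surj]] := exponential_iso RQ Ssn.
have [kI [kID kI_ker kI_surj]] := exponential_iso RIQ (monomial_sn_hull (I := I) Ssn).
have [t [tD t_ker t_surj]] := monomial_tensor I_ideal kD k_ker k_surj.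
have kIt z : kI z = 0 <-> t z = 0 by split=> [/kI_ker/t_ker|/t_ker/kI_ker].
exact: (@additive_bijection (monomial_quot S I) _ _ kI t kID tD kIt kI_surj t_surj).
Qed.

Theorem theorem1p3 (A B : comPzRingType) (f : {rmorphism A -> B})
    (Ap : intermediate f) (M : conomType) (I : set M)
    (f_inj : injective f) (Ap_closure : is_subintegral_closure Ap)
    (M_cancel : cancellative M) (M_torsion_free : torsion_free M)
    (M_affine : affine M)
    (I_ideal : monoid_ideal I) (I_radical : radical I) :
  let u : {rmorphism A -> int_ring Ap} := int_incl Ap in
  let v : {rmorphism int_ring Ap -> B} := @int_val _ _ _ Ap in
  let fI : {rmorphism monomial_quot A I -> monomial_quot B I} :=
    monomial_quot_map f I in
  let uI : {rmorphism monomial_quot A I -> monomial_quot (int_ring Ap) I} :=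
    monomial_quot_map u I in
  let vI : {rmorphism monomial_quot (int_ring Ap) I -> monomial_quot B I} :=
    monomial_quot_map v I in
  let vu : forall a, v (u a) = f a := @int_inclK _ _ _ Ap in
  let vuI : forall a, vI (uI a) = fI a :=
    @monomial_quot_map_comp _ _ _ u v f vu M I in
  let i : {additive inv_mod u -> inv_mod f} := inv_incl vu in
  let phi : {additive inv_mod f -> inv_mod v} := inv_extend vu in
  let i' : {additive inv_mod uI -> inv_mod fI} := inv_incl vuI in
  let phi' : {additive inv_mod fI -> inv_mod vI} := inv_extend vuI in
  let theta_u : {additive inv_mod u -> inv_mod uI} := theta u I in
  let theta_f : {additive inv_mod f -> inv_mod fI} := theta f I in
  let theta_v : {additive inv_mod v -> inv_mod vI} := theta v I in
  [/\ short_exact i phi,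
      short_exact i' phi',
      (forall J, i' (theta_u J) = theta_f (i J)) &
      (forall J, phi' (theta_f J) = theta_v (phi J))]
  /\
  ((exists q : {rmorphism rat -> A}, injective q) ->
   exists h : {additive inv_mod uI -> tensor (monomial_quot int I) (inv_mod u)},
     bijective h).
Proof.
move=> u v fI uI vI vu vuI i phi i' phi' theta_u theta_f theta_v.
have [Ap_sub _] := Ap_closure.
have Ap_sn := subintegral_sn_hull Ap_sub.
have ApI_sn := monomial_sn_hull (I := I) Ap_sn.
have v_inj : injective v by exact: val_inj.
split.
  split.
  - exact: (@tower_short_exact _ _ _ _ _ _ vu v_inj (tower_sn_hull vu Ap_sn)).
  - exact: (@tower_short_exact _ _ _ _ _ _ vuI
      (monomial_quot_map_inj I_ideal v_inj) (tower_sn_hull vuI ApI_sn)).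
  - exact: theta_incl.
  - exact: theta_extend.
move=> [q _]; apply: inv_mod_tensor => // n; exists (q n.+1%:R^-1).
rewrite -(rmorph_nat q) -rmorphM mulVf ?pnatr_eq0 //; exact: rmorph1.
Qed.
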